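(* Let $N\ge 1$, $\rho>0$ and let $f\in C^1([0,\infty))$ satisfy $f(s)>0$ and $f'(s)>0$ for all $s\in(0,\infty)$, and $F(s):=\int_s^\infty \frac{du}{f(u)}<\infty$ for all $s>0$. Assume that the limit $A=\lim_{s\to\infty}f'(s)F(s)$ exists with $A=1$, and that there exists a constant $s_3>0$ such that $f'(s)F(s)\le 1$ for all $s\ge s_3$. Then, for any $r\in(0,N/2)$, there exists a nonnegative measurable initial function $u_0$ satisfying $F(u_0)^{-r}\in L^1_{ul,\rho}(\mathbb{R}^N)$ such that for no $T>0$ does there exist a nonnegative classical solution $u\in C^{2,1}(\mathbb{R}^N\times(0,T))$ of $$\partial_t u=\Delta u+f(u)\ \text{ in }\mathbb{R}^N\times(0,T),\qquad u(x,0)=u_0(x)\ \text{ in }\mathbb{R}^N,$$ satisfying the initial condition in the sense $\lim_{t\to0}\|u(t)-e^{t\Delta}u_0\|_{L^\infty(\mathbb{R}^N)}=0$.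
   Context: $F(s)^{-r}$ means $(F(s))^{-r}$; $F(0):=\int_0^\infty du/f(u)\in(0,\infty]$, with $F(0)^{-r}=0$ if $F(0)=\infty$. For $y\in\mathbb{R}^N$, $B_\rho(y)$ is the ball of radius $\rho$ centered at $y$. $L^1_{ul,\rho}(\mathbb{R}^N)$ is the space of $u\in L^1_{loc}(\mathbb{R}^N)$ with $\|u\|_{L^1_{ul,\rho}(\mathbb{R}^N)}:=\sup_{y\in\mathbb{R}^N}\int_{B_\rho(y)}|u(x)|\,dx<\infty$. $(e^{t\Delta}\varphi)(x):=(4\pi t)^{-N/2}\int_{\mathbb{R}^N}e^{-|x-y|^2/(4t)}\varphi(y)\,dy$. $C^{2,1}(\mathbb{R}^N\times(0,T))$ denotes functions that are $C^2$ in $x$ and $C^1$ in $t$. A classical solution satisfies the equation pointwise in $\mathbb{R}^N\times(0,T)$, the initial condition being understood in the sense of the stated limit. *)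

(* Defs.v *)
From HB Require Import structures.
From mathcomp Require Import all_boot all_order all_algebra.
From mathcomp Require Import all_classical all_reals all_analysis.

Set Implicit Arguments.
Unset Strict Implicit.
Unset Printing Implicit Defensive.
Import Order.TTheory GRing.Theory Num.Theory.
Import numFieldNormedType.Exports.

Local Open Scope classical_set_scope.
Local Open Scope ring_scope.

Definition rV_display : measure_display.
Proof. exact: default_measure_display. Qed.

(* ['rV[R]_n] carries the sigma-algebra generated by the coordinates, i.e. the
   product of [n] copies of the Borel sigma-algebra of [R] (as the library does
   for [n.-tuple T]); it is the Borel sigma-algebra of [R^n]. *)
Section measurable_rV.
Context (R : realType) (n : nat).

Definition rV_coord (i : 'I_n) (x : 'rV[R]_n) : R := x ord0 i.

Let rV_set0 : g_sigma_preimage rV_coord set0.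
Proof. exact: sigma_algebra0. Qed.

Let rV_setC A : g_sigma_preimage rV_coord A -> g_sigma_preimage rV_coord (~` A).
Proof. exact: sigma_algebraC. Qed.

Let rV_bigcup (F : _^nat) : (forall i, g_sigma_preimage rV_coord (F i)) ->
  g_sigma_preimage rV_coord (\bigcup_i (F i)).
Proof. exact: sigma_algebra_bigcup. Qed.

HB.instance Definition _ :=
  @isMeasurable.Build rV_display 'rV[R]_n
    (g_sigma_preimage rV_coord) rV_set0 rV_setC rV_bigcup.

End measurable_rV.

Section lebesgue_rV.
Context (R : realType).

Lemma measurable_rV_coord n (i : 'I_n) :
  measurable_fun [set: 'rV[R]_n] (@rV_coord R n i).
Proof.
move=> _ Y mY; rewrite setTI; apply: sub_sigma_algebra => /=.
rewrite -bigcup_seq/=; exists i => /=; first by rewrite mem_index_enum.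
by exists Y => //; rewrite setTI.
Qed.

Lemma measurable_fun_rVP d (T : measurableType d) n (f : T -> 'rV[R]_n) :
  measurable_fun [set: T] f <->
  forall i, measurable_fun [set: T] (@rV_coord R n i \o f).
Proof.
apply: (@iff_trans _ (g_sigma_preimage
    (fun i => @rV_coord R n i \o f) `<=` measurable)).
  rewrite g_sigma_preimage_comp; split=> [mf A [/= C preC <-]|prefS].
    exact: mf.
  by move=> _ A mA; apply: prefS; exists A.
split=> [coordfS i|mf].
- move=> _ A mA.
  apply: coordfS; apply: sub_sigma_algebra.
  rewrite -bigcup_seq/=; exists i => /=; first by rewrite mem_index_enum.
  by exists A.
- apply: smallest_sub; first exact: sigma_algebra_measurable.
  rewrite -bigcup_seq/=; apply: bigcup_sub => i Ii.
  by move=> A [B mB <-]; exact: mf.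
Qed.

Definition rV_cons n (p : measurableTypeR R * 'rV[R]_n) : 'rV[R]_n.+1 :=
  row_mx p.1%:M p.2.

Definition rV_uncons n (x : 'rV[R]_n.+1) : measurableTypeR R * 'rV[R]_n :=
  (x ord0 ord0, \row_i x ord0 (lift ord0 i)).

Lemma rV_consK n : cancel (@rV_cons n) (@rV_uncons n).
Proof.
move=> [a y]; congr pair.
  rewrite mxE; case: splitP => j /= jE; last by [].
  by rewrite mxE (ord1 j) eqxx.
apply/rowP => i; rewrite !mxE; case: splitP => j /= jE.
  by move: (ltn_ord j); rewrite -jE.
by congr (y _ _); apply: val_inj; move: jE; rewrite /= /bump /= => -[].
Qed.

Lemma rV_unconsK n : cancel (@rV_uncons n) (@rV_cons n).
Proof.
move=> x; apply/rowP => i; rewrite mxE.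
case: splitP => j ji; rewrite !mxE.
  by rewrite !ord1 eqxx; congr (x _ _); apply: val_inj; rewrite /= ji ord1.
by congr (x _ _); apply: val_inj; rewrite /= ji.
Qed.

Lemma measurable_rV_cons n : measurable_fun setT (@rV_cons n).
Proof.
apply/measurable_fun_rVP => i.
have [->|i0] := eqVneq i ord0.
  rewrite (_ : _ \o _ = fst)//; apply/funext => p.
  by have /(congr1 fst) := rV_consK p.
have [j ->] : exists j, i = lift ord0 j.
  by case: (unliftP ord0 i) i0 => [j ->|->]; [exists j|rewrite eqxx].
rewrite (_ : _ \o _ = rV_coord j \o snd).
  by apply: measurableT_comp => //; exact: measurable_rV_coord.
apply/funext => p /=.
by have /(congr1 snd)/rowP/(_ j) := rV_consK p; rewrite mxE.
Qed.

Lemma measurable_rV_uncons n : measurable_fun setT (@rV_uncons n).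
Proof.
apply/measurable_fun_pairP; split; first exact: measurable_rV_coord.
apply/measurable_fun_rVP => i.
rewrite (_ : _ \o _ = rV_coord (lift ord0 i)); first exact: measurable_rV_coord.
by apply/funext => x; rewrite /rV_coord/= mxE.
Qed.

Section step.
Context (n : nat) (mu : {sigma_finite_measure set 'rV[R]_n -> \bar R}).

Definition lebesgue_rV_step : set 'rV[R]_n.+1 -> \bar R :=
  pushforward (@lebesgue_measure R \x mu)%E (@rV_cons n).

Let step0 : lebesgue_rV_step set0 = 0%E.
Proof. by rewrite /lebesgue_rV_step /pushforward preimage_set0 measure0. Qed.

Let step_ge0 A : (0 <= lebesgue_rV_step A)%E.
Proof. by rewrite /lebesgue_rV_step /pushforward; exact: measure_ge0. Qed.

Let step_sigma_additive : semi_sigma_additive lebesgue_rV_step.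
Proof.
exact: (@measure_semi_sigma_additive _ _ _
  (measure_function_pushforward__canonical__measure_function_Measure
    _ (@measurable_rV_cons n))).
Qed.

Let step_sigma_finite : sigma_finite setT lebesgue_rV_step.
Proof.
have /sigma_finiteP[F [TF ndF Foo]] := sigma_finiteT (@lebesgue_measure R).
have /sigma_finiteP[G [TG ndG Goo]] := sigma_finiteT mu.
exists (fun k => @rV_uncons n @^-1` (F k `*` G k)).
  rewrite -preimage_bigcup -[LHS](preimage_setT (@rV_uncons n)).
  congr (_ @^-1` _); rewrite -setXTT TF TG predeqE => -[x y]; split.
    move=> [/= [i _ Fix] [j _ Gjy]]; exists (maxn i j) => //; split.
    - by move: x Fix; exact/subsetPset/ndF/leq_maxl.
    - by move: y Gjy; exact/subsetPset/ndG/leq_maxr.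
  by move=> [i _ []/= ? ?]; split; exists i.
move=> k; have [mFk Fkoo] := Foo k; have [mGk Gkoo] := Goo k; split.
  rewrite -[X in measurable X]setTI; apply: measurable_rV_uncons => //.
  exact: measurableX.
rewrite /lebesgue_rV_step /pushforward -comp_preimage.
rewrite (_ : _ \o _ = id); last by apply/funext => p /=; rewrite rV_consK.
by rewrite preimage_id product_measure1E// lte_mul_pinfty// ge0_fin_numE.
Qed.

HB.instance Definition _ := isMeasure.Build _ _ _
  lebesgue_rV_step step0 step_ge0 step_sigma_additive.
HB.instance Definition _ := Measure_isSigmaFinite.Build _ _ _
  lebesgue_rV_step step_sigma_finite.

End step.

(* [N]-dimensional Lebesgue measure: [R^0] is a point of mass 1, and
   [R^(n+1)] is identified with [R * R^n]. *)
Fixpoint lebesgue_rV (N : nat) : {sigma_finite_measure set 'rV[R]_N -> \bar R} :=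
  match N with
  | 0 => \d_(0 : 'rV[R]_0)
  | n.+1 => lebesgue_rV_step (lebesgue_rV n)
  end.

End lebesgue_rV.

Section function_spaces.
Context (R : realType) (N : nat).
Implicit Types (x y : 'rV[R]_N) (g : 'rV[R]_N -> R).

(* The library's norm on matrices is the sup norm, hence a separate definition
   for the Euclidean one. *)
Definition enorm x : R := Num.sqrt (\sum_(i < N) x ord0 i ^+ 2).

Definition eball y (rho : R) : set 'rV[R]_N := [set x | enorm (x - y) < rho].

Definition L1loc g : Prop :=
  measurable_fun setT g /\
  forall K : set 'rV[R]_N, compact K ->
    (\int[lebesgue_rV R N]_(x in K) `|(g x)%:E| < +oo)%E.

Definition L1ul_norm (rho : R) g : \bar R :=
  ereal_sup [set (\int[lebesgue_rV R N]_(x in eball y rho) `|(g x)%:E|)%E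
            | y in setT].

Definition L1ul (rho : R) g : Prop := L1loc g /\ (L1ul_norm rho g < +oo)%E.

End function_spaces.

Section nonlinearity.
Context (R : realType).
Implicit Types (f : R -> R) (s r : R).

(* [f] is [C^1] on [[0, +oo[], with the one-sided derivative at [0]; the values
   of [f] on negative numbers are irrelevant. *)
Definition C1_nonneg f : Prop :=
  exists df : R -> R,
    {within `[0, +oo[%classic, continuous df} /\
    forall s, 0 <= s ->
      (f y - f s) / (y - s) @[y --> within `[0, +oo[%classic s^'] --> df s.

Definition bigF f s : \bar R :=
  (\int[lebesgue_measure]_(u in `]s, +oo[) ((f u)^-1)%:E)%E.

(* [F(s)^(-r)], equal to [0] when [F(s) = +oo]; the library's [poweR] is not
   used because it maps [+oo] to [+oo] for negative exponents too. *)
Definition bigF_negpow f r s : R :=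
  if bigF f s is a%:E then a `^ (- r) else 0.

End nonlinearity.

Section heat_equation.
Context (R : realType) (N : nat).
Implicit Types (g phi : 'rV[R]_N -> R) (u : 'rV[R]_N -> R -> R).

Definition heat (t : R) phi (x : 'rV[R]_N) : \bar R :=
  (((4 * pi * t) `^ (- (N%:R / 2)))%:E *
   \int[lebesgue_rV R N]_y
     (expR (- (enorm (x - y) ^+ 2 / (4 * t))) * phi y)%:E)%E.

Definition basis_vec (i : 'I_N) : 'rV[R]_N := delta_mx ord0 i.

Definition partial (i : 'I_N) g : 'rV[R]_N -> R := 'D_(basis_vec i) g.

Definition laplacian g (x : 'rV[R]_N) : R :=
  \sum_(i < N) partial i (partial i g) x.

(* The derivatives [u_t], [u_(x_i)], [u_(x_i x_j)] exist on [R^N x ]0, T[] and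
   are, like [u], jointly continuous there. *)
Definition C21 (T : R) u : Prop :=
  forall (x : 'rV[R]_N) (t : R), 0 < t < T ->
    [/\ {for (x, t), continuous (fun p : 'rV[R]_N * R => u p.1 p.2)},
        derivable (u x) t 1 /\
        {for (x, t), continuous (fun p : 'rV[R]_N * R => derive1 (u p.1) p.2)},
        forall i, derivable (u^~ t) x (basis_vec i) /\
          {for (x, t), continuous
            (fun p : 'rV[R]_N * R => partial i (u^~ p.2) p.1)} &
        forall i j, derivable (partial i (u^~ t)) x (basis_vec j) /\
          {for (x, t), continuous
            (fun p : 'rV[R]_N * R => partial j (partial i (u^~ p.2)) p.1)}].

(* The difference with [heat t u0] is taken in [\bar R], and [Lnorm] at [+oo]
   is the essential supremum. *)
Definition nonneg_classical_solution (f : R -> R)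
    (u0 : 'rV[R]_N -> R) (T : R) u : Prop :=
  [/\ C21 T u,
      forall (x : 'rV[R]_N) (t : R), 0 < t < T -> 0 <= u x t,
      forall (x : 'rV[R]_N) (t : R), 0 < t < T ->
        derive1 (u x) t = laplacian (u^~ t) x + f (u x t) &
      Lnorm (lebesgue_rV R N) +oo%E (fun x => ((u x t)%:E - heat t u0 x)%E)
        @[t --> 0^'+] --> 0%E].

End heat_equation.

(* Main.v *)
Require Import Defs.
From HB Require Import structures.
From mathcomp Require Import all_boot all_order all_algebra.
From mathcomp Require Import all_classical all_reals all_analysis.
From mathcomp Require Import measurable_realfun ess_sup_inf.
From mathcomp Require Import ring lra.

Set Implicit Arguments.
Unset Strict Implicit.
Unset Printing Implicit Defensive.
Import Order.TTheory GRing.Theory Num.Theory.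
Import numFieldNormedType.Exports.

Local Open Scope classical_set_scope.
Local Open Scope ring_scope.

(** Let [F] be the tail integral of [1/f]. A solution of the ordinary
    differential equation [v' = f v] that starts from [v0] blows up at time
    [F v0], while diffusion acts on the scale [|x|] in a time of order [|x|^2].
    The borderline initial singularity is therefore [F (u0 x) = |x|^2]. As
    [r < N/2], there is [beta] with [2 r / N < beta < 1], and [u0] is chosen such
    that [F (u0 x) ^ beta = |x|^2] near the origin, and constant further out.
    Then [F (u0 x) ^ (- r)] is [|x| ^ (- 2 r / beta)], which is locally integrable
    because [2 r / beta < N] ([singular_integral_bound]), but on the scale
    [|x|^2 = p] the blow-up time [p ^ (1 / beta)] is far shorter than [p].

    To see that no solution exists, recall that [f' F] tends to [1], so that
    [F ^ beta] is convex at large values, and so is its inverse. For every large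
    [m], with [p = F m ^ beta], the tangent at [p] provides the lower bound
    [m + sigma (p - |x|^2)] for [u0] ([profile_quadratic_ge]). The heat flow keeps
    it in the form [m + sigma (p - 2 |x|^2 - kappa t)] ([heat_quadratic_ge]). At small
    times the solution is uniformly close to the heat flow, so it satisfies that
    bound up to an arbitrarily small error, and the minimum principle propagates
    it to all later times, with a larger [kappa] ([solution_ge_quadratic]). The
    error disappears because the initial time of the comparison tends to [0].

    Hence [u >= m] on a parabolic cylinder of radius of order [sqrt p], during a
    time of order [p]. There [F u] is at most [F m], a quantity negligible with
    respect to [p], and is driven down at a rate close to [1], so that it would vanish
    within time [2 F m] ([no_large_cylinder]). This is impossible, and as [m] is
    arbitrarily large it happens before any given time [T]. *)

(** * Lebesgue measure and the Euclidean norm on R^N *)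

Section lebesgue_rV_theory.
Context (R : realType).
Local Notation mu := (lebesgue_rV R).

Lemma integral_lebesgue_rVS n (g : 'rV[R]_n.+1 -> \bar R) :
  measurable_fun setT g -> (forall x, 0 <= g x)%E ->
  (\int[mu n.+1]_x g x =
   \int[lebesgue_measure]_a \int[mu n]_y g (row_mx a%:M y))%E.
Proof.
move=> mg g0.
transitivity (\int[(lebesgue_measure \x mu n)%E]_p g (@rV_cons R n p))%E.
  exact: (@ge0_integral_pushforward _ _ _ _ _ _ (@measurable_rV_cons R n)
    (lebesgue_measure \x mu n)%E setT g measurableT mg (fun x _ => g0 x)).
rewrite (@fubini_tonelli1 _ _ _ _ _ _ _ (fun p => g (rV_cons p)))//.
apply: measurableT_comp => //; exact: measurable_rV_cons.
Qed.

(** Fubini for product integrands. It yields both the volume of boxes and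
    the mass of the Gaussian, the only explicit N-dimensional integrals that
    the proof needs. *)
Lemma integral_lebesgue_rV_prod n (phi : 'I_n -> R -> R) (c : 'I_n -> R) :
  (forall i, measurable_fun setT (phi i)) ->
  (forall i s, 0 <= phi i s) ->
  (forall i, \int[lebesgue_measure]_s (phi i s)%:E = (c i)%:E)%E ->
  (\int[mu n]_x (\prod_(i < n) phi i (x ord0 i))%:E = (\prod_(i < n) c i)%:E)%E.
Proof.
elim: n phi c => [|n IHn] phi c mphi phi0 intphi.
  rewrite big_ord0 /= integral_dirac//=; last first.
    apply/measurable_EFinP; rewrite (_ : (fun _ => _) = cst 1)//.
    by apply/funext => x; rewrite big_ord0.
  by rewrite diracT mul1e big_ord0.
have mcoord i : measurable_fun setT (fun x : 'rV[R]_n.+1 => phi i (x ord0 i)).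
  by apply: (@measurableT_comp _ _ _ _ _ _ (phi i)) => //; exact: measurable_rV_coord.
rewrite integral_lebesgue_rVS; last 2 first.
- apply/measurable_EFinP; apply: measurable_prod => i _; exact: mcoord.
- by move=> x; rewrite lee_fin prodr_ge0.
have step a : (\int[mu n]_y (\prod_(i < n.+1) phi i ((row_mx a%:M y : 'rV_n.+1) ord0 i))%:E =
    (phi ord0 a)%:E * (\prod_(i < n) c (lift ord0 i))%:E)%E.
  rewrite -(IHn (fun i => phi (lift ord0 i)) (fun i => c (lift ord0 i)))//.
  rewrite -ge0_integralZl//; last 3 first.
  - apply/measurable_EFinP; apply: measurable_prod => i _.
    by apply: (@measurableT_comp _ _ _ _ _ _ (phi _)) => //; exact: measurable_rV_coord.
  - by move=> y _; rewrite lee_fin prodr_ge0.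
  - by rewrite lee_fin.
  apply: eq_integral => y _; rewrite -EFinM big_ord_recl; congr (_ * _)%:E.
    by congr (phi _ _); have /(congr1 fst) := rV_consK (a, y).
  apply: eq_bigr => i _; congr (phi _ _).
  by have /(congr1 snd)/rowP/(_ i) := rV_consK (a, y); rewrite mxE.
under eq_integral do rewrite step.
rewrite ge0_integralZr//; last 3 first.
- apply/measurable_EFinP; exact: mphi.
- by move=> s _; rewrite lee_fin.
- rewrite lee_fin; apply: prodr_ge0 => i _.
  by rewrite -lee_fin -intphi integral_ge0// => s _; rewrite lee_fin.
by rewrite intphi -EFinM big_ord_recl.
Qed.

Definition box n (a : 'rV[R]_n) (e : R) : set 'rV[R]_n :=
  [set x | forall i, `|x ord0 i - a ord0 i| <= e].

Lemma indic_box n (a : 'rV[R]_n) e x :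
  \1_(box a e) x =
  \prod_(i < n) \1_(`[a ord0 i - e, a ord0 i + e]%classic) (x ord0 i) :> R.
Proof.
rewrite indicE; case: (boolP (x \in box a e)) => [/set_mem xB|/negP xB] /=.
  rewrite big1// => i _; rewrite indicE mem_set//= in_itv/=.
  by rewrite -ler_distlC distrC; exact: xB.
have [i xi] : exists i, ~~ (`|x ord0 i - a ord0 i| <= e).
  apply: contrapT => /forallNP xB'; apply: xB; apply/mem_set => i.
  by apply/negPn/negP; exact: xB'.
rewrite (bigD1 i)//= indicE memNset ?mul0r//= in_itv/=.
by rewrite -ler_distlC distrC; exact/negP.
Qed.

Lemma measurable_box n (a : 'rV[R]_n) e : measurable (box a e).
Proof.
have -> : box a e =
    \bigcap_(i in [set: 'I_n]) (@rV_coord R n i @^-1` `[a ord0 i - e, a ord0 i + e]%classic).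
  apply/seteqP; split => [x xB i _|x xB i].
    by rewrite /preimage/rV_coord/= in_itv/= -ler_distlC distrC; exact: xB.
  have := xB i I.
  by rewrite /preimage/rV_coord/= in_itv/= -ler_distlC distrC.
apply: fin_bigcap_measurable => // i _.
by rewrite -[X in measurable X]setTI; apply: measurable_rV_coord.
Qed.

Lemma measure_box n (a : 'rV[R]_n) e : 0 <= e -> mu n (box a e) = ((2 * e) ^+ n)%:E.
Proof.
move=> e0; have mB := measurable_box a e.
rewrite -(setIT (box a e)) -integral_indic//.
under eq_integral do rewrite indic_box.
rewrite (@integral_lebesgue_rV_prod _ (fun i => \1_(`[a ord0 i - e, a ord0 i + e]%classic)) (fun=> 2 * e))//.
- by rewrite prodr_const card_ord.
- move=> i; rewrite integral_indic//= setIT lebesgue_measure_itv/= lte_fin.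
  case: ltP => [_|h]; first by rewrite -EFinD; congr (_%:E); ring.
  by congr (_%:E); lra.
Qed.

Lemma box0 n (a : 'rV[R]_n) : box a 0 = [set a].
Proof.
apply/seteqP; split => [x xa|_ ->] /=; last by move=> i; rewrite subrr normr0.
by apply/rowP => i; apply/eqP; rewrite -subr_eq0 -normr_le0; exact: xa.
Qed.

Lemma measure_set1_rV n (a : 'rV[R]_n.+1) : mu n.+1 [set a] = 0%E.
Proof. by rewrite -box0 measure_box// mulr0 expr0n. Qed.

(** Boxes have positive volume, so a property that holds almost everywhere
    holds at points arbitrarily close to any given one. *)
Lemma ae_box_meets n (P : 'rV[R]_n -> Prop) :
  {ae mu n, forall x, P x} -> forall a e, 0 < e -> exists2 x, box a e x & P x.
Proof.
move=> [A [mA A0 PA]] a e e0; apply: contrapT => noP.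
have : (mu n (box a e) <= mu n A)%E.
  apply: le_measure; rewrite ?inE//; first exact: measurable_box.
  by move=> x xB; apply: PA => /= Px; apply: noP; exists x.
apply/negP; rewrite -ltNge A0 measure_box ?ltW// lte_fin.
by rewrite exprn_gt0// mulr_gt0.
Qed.

Lemma measurable_enorm n : measurable_fun setT (@enorm R n).
Proof.
apply: measurableT_comp.
  by apply: continuous_measurable_fun; exact: sqrt_continuous.
apply: measurable_sum => i; apply: measurable_funX; exact: measurable_rV_coord.
Qed.

Lemma enorm_ge0 n (x : 'rV[R]_n) : 0 <= enorm x.
Proof. exact: sqrtr_ge0. Qed.

Lemma enorm_sqr n (x : 'rV[R]_n) : enorm x ^+ 2 = \sum_(i < n) x ord0 i ^+ 2.
Proof. by rewrite sqr_sqrtr// sumr_ge0// => i _; exact: sqr_ge0. Qed.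

Lemma coord_sqr_le_enorm n (x : 'rV[R]_n) i :
  `|x ord0 i| ^+ 2 <= enorm x ^+ 2.
Proof.
rewrite enorm_sqr real_normK ?num_real// (bigD1 i)//= lerDl.
by apply: sumr_ge0 => j _; exact: sqr_ge0.
Qed.

Lemma coord_le_enorm n (x : 'rV[R]_n) i : `|x ord0 i| <= enorm x.
Proof.
by rewrite -(@ler_pXn2r _ 2)// ?nnegrE ?enorm_ge0//; exact: coord_sqr_le_enorm.
Qed.

Lemma enorm_gt0 n (x : 'rV[R]_n) : x != 0 -> 0 < enorm x.
Proof.
apply: contraNT; rewrite -leNgt => x0; apply/eqP/rowP => i.
apply/eqP; rewrite mxE -normr_le0; exact: le_trans (coord_le_enorm x i) x0.
Qed.

Lemma enorm_sqr_box n (x : 'rV[R]_n) (L : R) :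
  box 0 L x -> enorm x ^+ 2 <= n%:R * L ^+ 2.
Proof.
move=> xB; rewrite enorm_sqr -[n in n%:R]card_ord mulr_natl -sumr_const.
apply: ler_sum => i _; have := xB i; rewrite mxE subr0 => xi.
by rewrite -real_normK ?num_real// ler_pXn2r// ?nnegrE// (le_trans _ xi).
Qed.

Lemma measurable_sub_rV n (a : 'rV[R]_n) :
  measurable_fun setT (fun x : 'rV[R]_n => a - x).
Proof.
apply/measurable_fun_rVP => i.
rewrite (_ : _ \o _ = fun x => a ord0 i - @rV_coord R n i x); last first.
  by apply/funext => x /=; rewrite /rV_coord !mxE.
apply: measurable_funB => //; exact: measurable_rV_coord.
Qed.

Lemma integral_gauss_line (a d : R) : 0 < d ->
  (\int[lebesgue_measure]_s (expR (- ((a - s) ^+ 2 / d)))%:E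
   = (Num.sqrt (pi * d))%:E)%E.
Proof.
move=> d0; pose s := Num.sqrt (d / 2).
have s0 : s != 0 by rewrite gt_eqF// sqrtr_gt0 divr_gt0.
have s2 : s ^+ 2 = d / 2 by rewrite sqr_sqrtr// ltW// divr_gt0.
have pd0 : 0 < Num.sqrt (pi * d) by rewrite sqrtr_gt0 mulr_gt0// pi_gt0.
have /(congr1 (fun z => (Num.sqrt (pi * d))%:E * z)%E) := integral_normal_pdf a s.
rewrite mule1 -ge0_integralZl//=; last 2 first.
- by apply/measurable_EFinP; exact: measurable_normal_pdf.
- by move=> x _; rewrite lee_fin normal_pdf_ge0.
move=> <-; apply: eq_integral => x _.
rewrite -EFinM normal_pdfE// /normal_peak /normal_fun s2; congr (_%:E).
have -> : d / 2 * pi *+ 2 = pi * d by rewrite -mulr_natr; field.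
rewrite mulrA mulfV ?gt_eqF// mul1r; congr expR.
by rewrite -sqrrN opprB -mulr_natr; field; rewrite gt_eqF.
Qed.

Lemma integral_gauss_rV n (x : 'rV[R]_n) (d : R) : 0 < d ->
  (\int[mu n]_y (expR (- (enorm (x - y) ^+ 2 / d)))%:E
   = (Num.sqrt (pi * d) ^+ n)%:E)%E.
Proof.
move=> d0.
under eq_integral => y _.
  rewrite enorm_sqr mulr_suml -sumrN expR_sum.
  under eq_bigr do rewrite !mxE.
  over.
rewrite (@integral_lebesgue_rV_prod _ (fun i s => expR (- ((x ord0 i - s) ^+ 2 / d))) (fun=> Num.sqrt (pi * d)))//.
- by rewrite prodr_const card_ord.
- move=> i; apply: measurableT_comp => //; apply: measurableT_comp => //.
  apply: measurable_funM => //; apply: measurable_funX.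
  exact: measurable_funB.
- by move=> i; exact: integral_gauss_line.
Qed.

End lebesgue_rV_theory.

(** * Derivative tests at a minimum *)

Section calculus.
Context (R : realType).

Lemma directional_lineE (V : normedModType R) (g : V -> R) (x v : V) (s : R) :
  (derivable (fun h : R => g (x + h *: v)) s 1 <-> derivable g (x + s *: v) v) /\
  'D_1 (fun h : R => g (x + h *: v)) s = 'D_v g (x + s *: v).
Proof.
have E : (fun h : R => h^-1 *: (((fun h : R => g (x + h *: v)) \o shift s) (h *: 1) -
            g (x + s *: v))) =
         (fun h : R => h^-1 *: ((g \o shift (x + s *: v)) (h *: v) - g (x + s *: v))).
  apply/funext => h /=; congr (_ *: (g _ - _)).
  by rewrite [h *: 1]mulr1 scalerDl addrCA.
by rewrite /derivable /derive E.
Qed.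

(** If [g''(0) + 2 q] were negative, the derivative of [g + p h + q h^2],
    which vanishes at [0], would be negative just to the right of [0], and the
    mean value theorem would contradict minimality. *)
Lemma second_derivative_test (g : R -> R) (p q d : R) : 0 < d ->
  (forall h : R, `|h| < d -> derivable g h 1) -> derivable (derive1 g) 0 1 ->
  (forall h, `|h| < d -> g 0 <= g h + p * h + q * h ^+ 2) ->
  - (2 * q) <= derive1 (derive1 g) 0.
Proof.
move=> d0 dg dg' gmin; rewrite leNgt; apply/negP => neg.
pose k h := g h + p * h + q * h ^+ 2.
have dk (h : R) : `|h| < d -> is_derive h (1 : R) k (derive1 g h + p + q * (2 * h)).
  move=> hd; have /derivableP gh := dg _ hd; rewrite derive1E /k.
  apply: is_derive_eq; rewrite /GRing.scale/=; ring.
have k'0 : derive1 g 0 + p + q * (2 * 0) = 0.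
  have D0 : 'D_1 k 0 = 0.
    have : is_derive (0 : R) (1 : R) k 0.
      apply: (@derive1_at_min _ k (- d) d); rewrite ?in_itv/=.
      - by rewrite ge0_cp// ltW.
      - move=> t; rewrite in_itv/= -ltr_norml => td.
        by have [] := dk _ td.
      - by rewrite oppr_lt0 d0.
      - move=> t; rewrite in_itv/= -ltr_norml => td.
        by rewrite /k mulr0 expr0n/= mulr0 !addr0 gmin.
    by case.
  have h0 : `|0 : R| < d by rewrite normr0.
  by case: (dk _ h0) => _; rewrite D0 => <-.
have /cvgrPdist_lt : h^-1 *: ((derive1 g \o shift 0) (h *: 1) - derive1 g 0) @[h --> 0^'] --> derive1 (derive1 g) 0.
  by rewrite [derive1 (derive1 g) 0]derive1E; exact: dg'.
have e0 : 0 < - (derive1 (derive1 g) 0 + 2 * q) by lra.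
move=> /(_ _ e0) [e /= epos quot].
pose m := Num.min e d / 2.
have m0 : 0 < m by rewrite divr_gt0// lt_min epos d0.
have [me md] : m < e /\ m < d.
  have h1 : Num.min e d <= e by rewrite ge_min lexx.
  have h2 : Num.min e d <= d by rewrite ge_min lexx orbT.
  by rewrite /m; split; lra.
have k'neg h : 0 < h -> h <= m -> derive1 g h + p + q * (2 * h) < 0.
  move=> h0 hm; have := quot h; rewrite /ball/= sub0r normrN gtr0_norm//.
  rewrite gt_eqF// => /(_ (le_lt_trans hm me) isT).
  rewrite addr0 /GRing.scale/= mulr1 => hq.
  have {hq} : (derive1 g h - derive1 g 0) / h < - (2 * q).
    by move: hq; rewrite ltr_norml mulrC => /andP[]; lra.
  rewrite ltr_pdivrMr//; move: k'0; lra.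
have [c] : exists2 c, c \in `]0, m[%R & k m - k 0 = (derive1 g c + p + q * (2 * c)) * (m - 0).
  apply: (@MVT _ k (fun c => derive1 g c + p + q * (2 * c)) 0 m m0).
  - move=> x; rewrite in_itv/= => /andP[x0 xm].
    by apply: dk; rewrite gtr0_norm// (lt_trans xm).
  - apply: derivable_within_continuous => x; rewrite in_itv/= => /andP[x0 xm].
    by have [] := dk x; rewrite // ger0_norm// (le_lt_trans xm).
rewrite in_itv/= subr0 => /andP[c0 cm] km.
have : k 0 <= k m.
  by rewrite /k mulr0 expr0n/= mulr0 !addr0 gmin// gtr0_norm.
by rewrite -subr_ge0 km pmulr_lge0// leNgt k'neg// ltW.
Qed.

Lemma left_derivative_test (g : R -> R) (C t d : R) : 0 < d ->
  derivable g t 1 ->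
  (forall s, t - d < s -> s <= t -> g t + C * t <= g s + C * s) ->
  derive1 g t <= - C.
Proof.
move=> d0 dg gmin; rewrite leNgt; apply/negP => pos.
have /cvgrPdist_lt : h^-1 *: ((g \o shift t) (h *: 1) - g t) @[h --> 0^'] --> derive1 g t.
  by rewrite derive1E; exact: dg.
have e0 : 0 < derive1 g t + C by lra.
move=> /(_ _ e0) [e /= epos quot].
pose m := Num.min e d / 2.
have m0 : 0 < m by rewrite divr_gt0// lt_min epos d0.
have [me md] : m < e /\ m < d.
  have h1 : Num.min e d <= e by rewrite ge_min lexx.
  have h2 : Num.min e d <= d by rewrite ge_min lexx orbT.
  by rewrite /m; split; lra.
have := quot (- m); rewrite /ball/= sub0r opprK gtr0_norm// oppr_eq0 gt_eqF//.
move=> /(_ me isT); rewrite /GRing.scale/= mulr1 => hq.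
have h1 : t - d < - m + t by lra.
have h2 : - m + t <= t by lra.
have {h1 h2} h := gmin _ h1 h2.
have : - C < (g t - g (- m + t)) / m.
  move: hq; rewrite invrN mulNr -mulrN opprB mulrC ltr_norml => /andP[]; lra.
rewrite ltr_pdivlMr//; lra.
Qed.

End calculus.

Section parabolic.
Context (R : realType) (N : nat).
Implicit Types (x y : 'rV[R]_N) (u : 'rV[R]_N -> R -> R).

Lemma compact_box (a : 'rV[R]_N) (e : R) : compact (box a e).
Proof.
have -> : box a e = [set v : 'rV[R]_N |
    forall i, (`[a ord0 i - e, a ord0 i + e]%classic : set R) (v ord0 i)].
  apply/seteqP; split => x xB i; move: (xB i) => /=;
  by rewrite in_itv/= -ler_distlC distrC.
apply: (@rV_compact _ _ (fun i => `[a ord0 i - e, a ord0 i + e]%classic)) => i.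
exact: segment_compact.
Qed.

Lemma enorm_sqr_line x (i : 'I_N) (h : R) :
  enorm (x + h *: basis_vec R i) ^+ 2 =
  enorm x ^+ 2 + 2 * x ord0 i * h + h ^+ 2.
Proof.
rewrite !enorm_sqr (bigD1 i)//= [in RHS](bigD1 i)//= !mxE !eqxx/=.
under eq_bigr => j ji do rewrite !mxE eqxx (negbTE ji) mulr0 addr0.
by ring.
Qed.

Lemma continuous_enorm_sqr : continuous (fun x : 'rV[R]_N => enorm x ^+ 2).
Proof.
have -> : (fun x : 'rV[R]_N => enorm x ^+ 2) =
    (fun x => \sum_(i < N) x ord0 i ^+ 2).
  by apply/funext => x; rewrite enorm_sqr.
apply: continuous_big => [|i _ x]; first exact: add_continuous.
have ci := @coord_continuous R 1 N ord0 i x.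
exact: (cvgM ci ci).
Qed.

Lemma continuous_quadratic (a b : R) :
  continuous (fun x : 'rV[R]_N => a + b * enorm x ^+ 2).
Proof.
move=> x.
have ha : (fun=> a) y @[y --> x] --> a by exact: cst_continuous.
have hb : (fun=> b) y @[y --> x] --> b by exact: cst_continuous.
exact: (cvgD ha (cvgM hb (@continuous_enorm_sqr x))).
Qed.

Lemma continuous_parabola (a b c : R) :
  continuous (fun p : 'rV[R]_N * R => a + b * enorm p.1 ^+ 2 + c * p.2).
Proof.
move=> p; have hc : (fun=> c) q @[q --> p] --> c by exact: cst_continuous.
have h1 : a + b * enorm q.1 ^+ 2 @[q --> p] --> a + b * enorm p.1 ^+ 2.
  apply: (@continuous_comp _ _ _ fst (fun y : 'rV[R]_N => a + b * enorm y ^+ 2)).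
    exact: cvg_fst.
  exact: continuous_quadratic.
have h2 : q.2 @[q --> p] --> p.2 by exact: cvg_snd.
exact: (cvgD h1 (cvgM hc h2)).
Qed.

(** The minimum over the compact cylinder is attained, and not on the parabolic
    boundary, where the values are at least [c]. The final time [t1] counts as
    interior, as is usual for parabolic equations. *)
Lemma box_interior_min (W : 'rV[R]_N * R -> R) (L t0 t1 c : R) :
  (forall y s, box 0 L y -> t0 <= s <= t1 -> {for (y, s), continuous W}) ->
  (forall y, box 0 L y -> c <= W (y, t0)) ->
  (forall y s i, box 0 L y -> t0 <= s <= t1 -> `|y ord0 i| = L -> c <= W (y, s)) ->
  (exists y s, [/\ box 0 L y, t0 <= s <= t1 & W (y, s) < c]) ->
  exists x t, [/\ forall i, `|x ord0 i| < L, t0 < t <= t1, W (x, t) < c &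
    forall y s, box 0 L y -> t0 <= s <= t1 -> W (x, t) <= W (y, s)].
Proof.
move=> cW Winit Wside [y0 [s0 [y0B s0t W0]]].
pose K := box (0 : 'rV[R]_N) L `*` `[t0, t1]%classic.
have cK : compact K by apply: compact_setX; [exact: compact_box|exact: segment_compact].
have [|[x t] xtK Wmin] := @compact_EVT_min _ _ W K (ex_intro _ (y0, s0) (conj y0B s0t)) cK.
  by apply: continuous_in_subspaceT => -[y s] /set_mem[/= yB st]; exact: cW.
move/set_mem: xtK => [/= xB]; rewrite in_itv/= => tt.
have Wxt : W (x, t) < c.
  by apply: le_lt_trans W0; apply: Wmin; apply/mem_set; split.
exists x, t; split => //.
- move=> i; rewrite lt_neqAle; have := xB i; rewrite mxE subr0 => ->.
  rewrite andbT; apply/eqP => xi.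
  by have := Wside x t i xB tt xi; rewrite leNgt Wxt.
- have /andP[t0t ->] := tt; rewrite andbT lt_neqAle t0t andbT.
  by apply/eqP => tE; have := Winit x xB; rewrite tE leNgt Wxt.
- by move=> y s yB st; apply: Wmin; apply/mem_set; split.
Qed.

(** The only form of the maximum principle that is used. Comparison functions
    are replaced by tangent polynomials [B |x|^2 + C t] at the minimum, so that
    [u] is the only function whose second derivatives ever appear. *)
Lemma parabolic_min_test u (T L t0 t B C : R) x : C21 T u ->
  0 < t0 -> t0 < t < T -> (forall i, `|x ord0 i| < L) ->
  (forall y s, box 0 L y -> t0 <= s <= t ->
     u x t + B * enorm x ^+ 2 + C * t <= u y s + B * enorm y ^+ 2 + C * s) ->
  derive1 (u x) t - laplacian (u^~ t) x <= 2 * N%:R * B - C.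
Proof.
move=> uC t00 /andP[t0t tT] xL umin.
have t0T : 0 < t < T by rewrite (lt_trans t00).
have xB : box 0 L x by move=> i; rewrite mxE subr0 ltW.
have ut : derive1 (u x) t <= - C.
  apply: (@left_derivative_test _ _ _ _ (t - t0)); first by rewrite subr_gt0.
    by have [_ []] := uC x t t0T.
  move=> s; rewrite subKr => t0s st.
  by have := umin x s xB; rewrite (ltW t0s) st => /(_ isT); lra.
have lap : - (2 * B) * N%:R <= laplacian (u^~ t) x.
  rewrite mulr_natr -[X in _ *+ X]card_ord -sumr_const; apply: ler_sum => i _.
  pose d := L - `|x ord0 i|.
  have d0 : 0 < d by rewrite subr_gt0.
  pose g h := u (x + h *: basis_vec R i) t.
  have du y : derivable (u^~ t) y (basis_vec R i).
    by have [_ _ /(_ i)[]] := uC y t t0T.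
  have g'E : derive1 g = fun h => partial i (u^~ t) (x + h *: basis_vec R i).
    apply/funext => h; rewrite derive1E.
    by have [_] := directional_lineE (u^~ t) x (basis_vec R i) h.
  have g''E : derive1 (derive1 g) 0 = partial i (partial i (u^~ t)) x.
    rewrite g'E derive1E.
    by have [_ ->] := directional_lineE (partial i (u^~ t)) x (basis_vec R i) 0; rewrite scale0r addr0.
  have : - (2 * B) <= derive1 (derive1 g) 0; last by move/le_trans; apply; rewrite g''E.
  apply: (@second_derivative_test _ g (2 * B * x ord0 i) B d d0).
  - move=> h _; have [H _] := directional_lineE (u^~ t) x (basis_vec R i) h.
    exact: (proj2 H (du _)).
  - rewrite g'E; have [H _] := directional_lineE (partial i (u^~ t)) x (basis_vec R i) 0.
    by apply: (proj2 H); rewrite scale0r addr0; have [_ _ _ /(_ i i)[]] := uC x t t0T.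
  - move=> h hd; rewrite {1}/g scale0r addr0 /g.
    have yB : box 0 L (x + h *: basis_vec R i).
      move=> j; rewrite !mxE subr0 eqxx/=.
      have [->|_] := eqVneq j i; last by rewrite mulr0 addr0 ltW.
      rewrite mulr1; apply: (le_trans (ler_normD _ _)).
      by rewrite -lerBrDl; exact: ltW.
    have := umin _ t yB; rewrite lexx (ltW t0t) enorm_sqr_line => /(_ isT); lra.
lra.
Qed.

End parabolic.

(** * The tail integral of 1/f *)

(** The finite part of [bigF], locked because conversion would otherwise unfold
    it down to the Lebesgue integral. *)
HB.lock Definition tailF (R : realType) (f : R -> R) (s : R) : R :=
  fine (bigF f s).

Section tail_integral.
Context (R : realType) (f : R -> R).
Local Notation tailF := (tailF f).
Hypothesis fC1 : C1_nonneg f.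
Hypothesis f_gt0 : forall s : R, 0 < s -> 0 < f s.
Hypothesis f'_gt0 : forall s : R, 0 < s -> 0 < derive1 f s.
Hypothesis F_fin : forall s : R, 0 < s -> (bigF f s < +oo)%E.

Lemma C1_nonneg_is_derive (s : R) : 0 < s -> is_derive s (1 : R) f (derive1 f s).
Proof.
have [df [_ quot]] := fC1 => s0.
have : derivable f s 1; last by move/derivableP; rewrite derive1E.
apply/cvg_ex; exists (df s) => /=.
have /cvgrPdist_lt fs := quot s (ltW s0).
apply/cvgrPdist_lt => e e0; have [d /= d0 fd] := fs e e0.
exists (Num.min d s) => /=; first by rewrite lt_min d0.
move=> h /=; rewrite sub0r normrN lt_min => /andP[hd hs] h0.
have := fd (h + s); rewrite /ball_/= opprD addrC subrK.
rewrite normrN => /(_ hd).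
rewrite addrK [h *: 1]mulr1 mulrC; apply.
  by apply/eqP => hsE; move/eqP: h0; apply; apply/eqP; rewrite -(addrK s h) hsE subrr.
by rewrite in_itv/= andbT; move: hs; rewrite ltr_norml => /andP[]; lra.
Qed.

Lemma C1_nonneg_continuous (s : R) : 0 < s -> {for s, continuous f}.
Proof.
move=> s0; apply: differentiable_continuous; apply/derivable1_diffP.
by case: (C1_nonneg_is_derive s0).
Qed.

(** At [s = 0]: if [f 0] were negative, then, [f] being positive to the right
    of [0], the difference quotient at [0] would be unbounded. *)
Lemma C1_nonneg_ge0 (s : R) : 0 <= s -> 0 <= f s.
Proof.
rewrite le_eqVlt => /predU1P[<-|/f_gt0/ltW//].
rewrite leNgt; apply/negP => f0.
have [df [_ /(_ 0 (lexx _)) /cvgrPdist_lt /(_ 1 ltr01)[d /= d0 fd]]] := fC1.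
pose D := `|df 0| + 1.
have D0 : 0 < D by rewrite ltr_pwDr.
pose h := Num.min d (- f 0 / D) / 2.
have h0 : 0 < h by rewrite divr_gt0// lt_min d0 divr_gt0// oppr_gt0.
have [hd hD] : h < d /\ h < - f 0 / D.
  have h1 : Num.min d (- f 0 / D) <= d by rewrite ge_min lexx.
  have h2 : Num.min d (- f 0 / D) <= - f 0 / D by rewrite ge_min lexx orbT.
  by rewrite /h; split; move: h0; rewrite /h; lra.
have := fd h; rewrite /ball_/= !(sub0r, subr0) normrN gtr0_norm// => /(_ hd).
rewrite gt_eqF// in_itv/= ltW// => /(_ isT isT).
rewrite ltr_norml => /andP[q1 q2].
have q3 : (f h - f 0) / h < D.
  by rewrite /D; have := ler_norm (df 0); lra.
rewrite ltr_pdivrMr// in q3; rewrite ltr_pdivlMr// in hD.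
have := f_gt0 h0; lra.
Qed.

Lemma f_ndecr (s t : R) : 0 < s -> s <= t -> f s <= f t.
Proof.
move=> s0 st; apply: (@ger0_derive1_ndecry _ f s) => //.
- move=> x; rewrite in_itv/= andbT => sx.
  by case: (C1_nonneg_is_derive (lt_trans s0 sx)).
- move=> x; rewrite in_itv/= andbT => sx.
  by rewrite ltW// f'_gt0// (lt_trans s0).
- apply: derivable_within_continuous => x; rewrite in_itv/= andbT => sx.
  by case: (C1_nonneg_is_derive (lt_le_trans s0 sx)).
Qed.

Lemma continuous_invf (s : R) : 0 < s -> {for s, continuous (fun u => (f u)^-1)}.
Proof.
move=> s0; apply: cvgV; first by rewrite gt_eqF ?f_gt0.
exact: C1_nonneg_continuous.
Qed.

Lemma measurable_invf : measurable_fun (`]0, +oo[%classic : set R) (fun u => (f u)^-1).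
Proof.
apply: open_continuous_measurable_fun; first exact: interval_open.
by move=> s; rewrite inE/= in_itv/= andbT; exact: continuous_invf.
Qed.

Lemma bigF_tailF (s : R) : 0 < s -> bigF f s = (tailF s)%:E.
Proof.
move=> s0; rewrite unlock fineK// ge0_fin_numE ?F_fin//.
apply: integral_ge0 => u; rewrite /= in_itv/= andbT => su.
by rewrite lee_fin invr_ge0 ltW// f_gt0// (lt_trans s0).
Qed.

Lemma tailF_ge0 (s : R) : 0 < s -> 0 <= tailF s.
Proof.
move=> s0; rewrite -lee_fin -bigF_tailF//.
apply: integral_ge0 => u; rewrite /= in_itv/= andbT => su.
by rewrite lee_fin invr_ge0 ltW// f_gt0// (lt_trans s0).
Qed.

Lemma integrable_invf (a : R) (I : interval R) : 0 < a -> [set` I] `<=` `]a, +oo[%classic ->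
  lebesgue_measure.-integrable [set` I] (EFin \o (fun u => (f u)^-1)).
Proof.
move=> a0 Ia; have ma : measurable_fun (`]a, +oo[%classic : set R) (fun u => (f u)^-1).
  apply: measurable_funS measurable_invf => // x.
  by rewrite /= !in_itv/= !andbT; exact: lt_trans.
suff intA : lebesgue_measure.-integrable (`]a, +oo[%classic : set R)
    (EFin \o (fun u => (f u)^-1)).
  by apply: (@integrableS _ (measurableTypeR R) R lebesgue_measure _ _ _ _ _ Ia intA) => //; exact: measurable_itv.
apply/integrableP; split; first exact/measurable_EFinP.
have := F_fin a0; rewrite /bigF; congr (_ < _)%E.
apply: eq_integral => u; rewrite inE/= in_itv/= andbT => au.
by rewrite ger0_norm// invr_ge0 ltW// f_gt0// (lt_trans a0).
Qed.

Lemma tailF_split (a s : R) : 0 < a -> a <= s ->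
  tailF a = \int[lebesgue_measure]_(u in `]a, s]) (f u)^-1 + tailF s.
Proof.
move=> a0 as'; have s0 := lt_le_trans a0 as'.
pose I := (\int[lebesgue_measure]_(u in `]a, s]) ((f u)^-1)%:E)%E.
have Ifin : I \is a fin_num.
  apply: integrable_fin_num => //; apply: (integrable_invf a0) => x.
  by rewrite /= !in_itv/= andbT => /andP[].
suff FI : bigF f a = (I + bigF f s)%E.
  apply: EFin_inj; rewrite EFinD /Rintegral (fineK Ifin).
  by rewrite -(bigF_tailF a0) -(bigF_tailF s0).
rewrite /bigF /I -ge0_integral_setU//=.
- congr (integral _ _ _); rewrite -itv_bndbnd_setU// bnd_simp//.
- rewrite -itv_bndbnd_setU ?bnd_simp//; apply/measurable_EFinP.
  apply: measurable_funS measurable_invf => // x.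
  by rewrite /= !in_itv/= !andbT; exact: lt_trans.
- move=> x xI; have {xI} ax : a < x.
    case: xI; rewrite in_itv/= ?andbT; first by move=> /andP[].
    exact: le_lt_trans.
  by rewrite lee_fin invr_ge0 ltW// f_gt0// (lt_trans a0).
- apply/disj_setPRL => x /=; rewrite !in_itv/= andbT => sx /andP[_].
  by rewrite leNgt sx.
Qed.

Lemma tailF_is_derive (s : R) : 0 < s -> is_derive s (1 : R) tailF (- (f s)^-1).
Proof.
move=> s0; pose a := s / 2.
have a0 : 0 < a by rewrite divr_gt0.
have as' : a < s by rewrite /a; lra.
pose P x := \int[lebesgue_measure]_(u in `]a, x]) (f u)^-1.
have [dP P's] : derivable P s 1 /\ derive1 P s = (f s)^-1.
  apply: (@continuous_FTC1 _ (fun u => (f u)^-1) (BRight a) s (s + 1)).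
  - by rewrite ltrDl.
  - by apply: (integrable_invf a0) => x; rewrite /= !in_itv/= andbT => /andP[].
  - exact: as'.
  - exact: continuous_invf.
have dP' : is_derive s (1 : R) P (f s)^-1.
  by move/derivableP: dP; rewrite -derive1E P's.
apply: (@near_eq_is_derive _ _ _ (fun x => tailF a - P x)).
- have : \forall x \near s, a < x by exact: lt_nbhsr.
  apply: filterS => x ax.
  by rewrite (tailF_split a0 (ltW ax)) -/(P x) addrC addKr.
- by apply: is_derive_eq; rewrite ?add0r mul1r.
Qed.

Lemma tailF_continuous (s : R) : 0 < s -> {for s, continuous tailF}.
Proof.
move=> s0; apply: differentiable_continuous; apply/derivable1_diffP.
by case: (tailF_is_derive s0).
Qed.

Lemma tailF_decr (s t : R) : 0 < s -> s < t -> tailF t < tailF s.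
Proof.
move=> s0 st; rewrite -subr_lt0.
have [||c] := @MVT _ tailF (fun x => - (f x)^-1) s t st.
- move=> x; rewrite in_itv/= => /andP[sx _].
  by apply: tailF_is_derive; exact: lt_trans sx.
- apply: derivable_within_continuous => x; rewrite in_itv/= => /andP[sx _].
  by case: (tailF_is_derive (lt_le_trans s0 sx)).
rewrite in_itv/= => /andP[sc _] ->.
by rewrite mulNr oppr_lt0 mulr_gt0 ?subr_gt0// invr_gt0 f_gt0// (lt_trans s0).
Qed.

Lemma tailF_gt0 (s : R) : 0 < s -> 0 < tailF s.
Proof.
move=> s0; apply: (@le_lt_trans _ _ (tailF (s + 1))).
  by rewrite tailF_ge0// ltr_wpDl// ltW.
by rewrite tailF_decr// ltrDl.
Qed.

(** The infimum [l] of [tailF] is its limit at infinity; since [- tailF] is an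
    antiderivative of [1/f], the integral defining [tailF a] equals
    [tailF a - l], so that [l = 0]. *)
Lemma tailF_small (a e : R) : 0 < a -> 0 < e -> exists2 m, a <= m & tailF m < e.
Proof.
move=> a0 e0; pose S := tailF @` `[a, +oo[%classic; pose l := inf S.
have Sinf : has_inf S.
  split; first by exists (tailF a), a => //=; rewrite in_itv/= lexx.
  exists 0 => _ [s + <-]; rewrite /= in_itv/= andbT => as'.
  by rewrite tailF_ge0// (lt_le_trans a0).
have lF s : a <= s -> l <= tailF s.
  by move=> as'; apply: (ge_inf Sinf.2); exists s => //=; rewrite in_itv/= as'.
have adh d : 0 < d -> exists2 m, a <= m & tailF m < l + d.
  move=> d0; have [_ [m + <-]] := inf_adherent d0 Sinf.
  by rewrite /= in_itv/= andbT => am mld; exists m.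
suff l0 : l = 0 by have [m am] := adh e e0; rewrite l0 add0r; exists m.
have Fl : - tailF x @[x --> +oo%R] --> - l.
  apply: cvgN; apply/cvgrPdist_lt => d d0; have [m am mld] := adh d d0.
  near=> x; have mx : m < x by near: x; apply: nbhs_pinfty_gt; exact: num_real.
  have := tailF_decr (lt_le_trans a0 am) mx.
  have := lF x (ltW (le_lt_trans am mx)).
  by rewrite distrC => lx xm; rewrite ger0_norm ?subr_ge0//; lra.
have : bigF f a = ((- l)%:E - (- tailF a)%:E)%E.
  rewrite /bigF integral_itv_obnd_cbnd; last first.
    apply/measurable_EFinP; apply: measurable_funS measurable_invf => // x.
    by rewrite /= !in_itv/= !andbT; exact: lt_trans.
  apply: (@ge0_continuous_FTC2y _ _ (fun x => - tailF x)) => //.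
  - by move=> x ax; rewrite invr_ge0 ltW// f_gt0// (lt_le_trans a0).
  - apply: continuous_in_subspaceT => x; rewrite inE/= in_itv/= andbT => ax.
    by apply: continuous_invf; exact: lt_le_trans ax.
  - move=> x ax; apply: derivableN.
    by case: (tailF_is_derive (lt_trans a0 ax)).
  - apply: cvg_at_right_filter; apply: cvgN; exact: tailF_continuous.
  - move=> x; rewrite in_itv/= andbT => ax; rewrite derive1E.
    rewrite deriveN; last by case: (tailF_is_derive (lt_trans a0 ax)).
    by case: (tailF_is_derive (lt_trans a0 ax)) => _ ->; rewrite opprK.
by rewrite bigF_tailF// -EFinB => -[]; lra.
Unshelve. all: by end_near. Qed.

(** [tailF] is convex, because its derivative [- 1/f] is nondecreasing. *)
Lemma tailF_tangent (s m : R) : 0 < s -> 0 < m ->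
  tailF m - (s - m) / f m <= tailF s.
Proof.
have mvt (x y : R) : 0 < x -> x < y -> exists2 c, x < c < y &
    tailF y - tailF x = - (f c)^-1 * (y - x).
  move=> x0 xy; have [||c] := @MVT _ tailF (fun z => - (f z)^-1) x y xy.
  - move=> z; rewrite in_itv/= => /andP[xz _].
    by apply: tailF_is_derive; exact: lt_trans xz.
  - apply: derivable_within_continuous => z; rewrite in_itv/= => /andP[xz _].
    by case: (tailF_is_derive (lt_le_trans x0 xz)).
  - by rewrite in_itv/= => cxy cE; exists c.
move=> s0 m0; have [sm|ms|<-] := ltgtP s m; last by rewrite subrr mul0r subr0.
- have [c /andP[sc cm] E] := mvt s m s0 sm.
  have c0 := lt_trans s0 sc.
  have : (f m)^-1 <= (f c)^-1.
    by rewrite lef_pV2 ?posrE ?f_gt0// f_ndecr// ltW.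
  have : 0 < m - s by rewrite subr_gt0.
  move: E; nra.
- have [c /andP[mc cs] E] := mvt m s m0 ms.
  have c0 := lt_trans m0 mc.
  have : (f c)^-1 <= (f m)^-1.
    by rewrite lef_pV2 ?posrE ?f_gt0// f_ndecr// ltW.
  have : 0 < s - m by rewrite subr_gt0.
  move: E; nra.
Qed.

Section power.
Variables (beta s1 : R).
Hypothesis beta01 : 0 < beta < 1.
Hypothesis s1_gt0 : 0 < s1.
Hypothesis f'F_ge : forall s, s1 <= s -> 1 - beta <= derive1 f s * tailF s.

Lemma is_derive_powR (a x : R) : 0 < x ->
  is_derive x (1 : R) (fun z : R => z `^ a) (a * x `^ (a - 1)).
Proof.
move=> x0; have xin : x \in `]0, +oo[%R by rewrite in_itv/= andbT.
have /derivableP := @derivable_powR _ 1 a _ xin.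
by rewrite -derive1E (powR_derive1 _ xin).
Qed.

Lemma is_derive_tailF_powR (a s : R) : 0 < s ->
  is_derive s (1 : R) (fun z : R => tailF z `^ a)
    (- (a * tailF s `^ (a - 1) / f s)).
Proof.
move=> s0.
have := is_derive1_comp (is_derive_powR a (tailF_gt0 s0)) (tailF_is_derive s0).
by rewrite mulrN.
Qed.

(** [beta] divided by the absolute value of the derivative of [tailF ^ beta]. *)
Definition tail_weight (s : R) : R := f s * tailF s `^ (1 - beta).

Lemma tail_weight_gt0 s : 0 < s -> 0 < tail_weight s.
Proof. by move=> s0; rewrite mulr_gt0 ?f_gt0// powR_gt0// tailF_gt0. Qed.

Lemma tail_weight_ndecr s t : s1 <= s -> s <= t -> tail_weight s <= tail_weight t.
Proof.
have dweight (x : R) : 0 < x -> is_derive x (1 : R) tail_weight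
    (tailF x `^ (- beta) * (derive1 f x * tailF x - (1 - beta))).
  move=> x0; have dx := C1_nonneg_is_derive x0.
  have dF := is_derive_tailF_powR (1 - beta) x0.
  rewrite /tail_weight; apply: is_derive_eq; rewrite /GRing.scale/=.
  have -> : 1 - beta - 1 = - beta by ring.
  have -> : tailF x `^ (1 - beta) = tailF x `^ (- beta) * tailF x.
    rewrite powRD; last by apply/implyP => _; rewrite gt_eqF// tailF_gt0.
    by rewrite powRr1 1?mulrC// ltW// tailF_gt0.
  by field; rewrite gt_eqF ?f_gt0.
move=> s1s st; have s0 := lt_le_trans s1_gt0 s1s.
apply: (@ger0_derive1_ndecry _ tail_weight s) => //.
- move=> x; rewrite in_itv/= andbT => sx.
  by case: (dweight x (lt_trans s0 sx)).
- move=> x; rewrite in_itv/= andbT => sx.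
  have [_ E] := dweight x (lt_trans s0 sx).
  rewrite derive1E E mulr_ge0 ?powR_ge0// subr_ge0.
  by apply: f'F_ge; rewrite (le_trans s1s)// ltW.
- apply: derivable_within_continuous => x; rewrite in_itv/= andbT => sx.
  by case: (dweight x (lt_le_trans s0 sx)).
Qed.

(** [tailF ^ beta] is convex on [[s1, +oo[], by the hypothesis
    [1 - beta <= f' F]; this is its tangent inequality at [m], solved for [s].
    It says that the inverse function of [tailF ^ beta] lies above its tangents. *)
Lemma tailF_powR_tangent s m : s1 <= s -> s1 <= m ->
  m - tail_weight m / beta * (tailF s `^ beta - tailF m `^ beta) <= s.
Proof.
move=> s1s s1m; have s0 := lt_le_trans s1_gt0 s1s.
have m0 := lt_le_trans s1_gt0 s1m.
have b0 : 0 < beta by case/andP: beta01.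
pose K x := x + tail_weight m / beta * tailF x `^ beta.
have dK (x : R) : 0 < x -> is_derive x (1 : R) K (1 - tail_weight m / tail_weight x).
  move=> x0; have dF := is_derive_tailF_powR beta x0.
  apply: is_derive_eq; rewrite /GRing.scale/= [in tail_weight x]/tail_weight.
  have -> : beta - 1 = - (1 - beta) by ring.
  rewrite powRN; field; rewrite !gt_eqF ?f_gt0 ?powR_gt0 ?tailF_gt0//.
have mvt (x y : R) : 0 < x -> x < y -> exists2 c, x < c < y &
    K y - K x = (1 - tail_weight m / tail_weight c) * (y - x).
  move=> x0 xy; have [||c] := @MVT _ K (fun z => 1 - tail_weight m / tail_weight z) x y xy.
  - by move=> z; rewrite in_itv/= => /andP[xz _]; apply: dK; exact: lt_trans xz.
  - apply: derivable_within_continuous => z; rewrite in_itv/= => /andP[xz _].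
    by case: (dK _ (lt_le_trans x0 xz)).
  - by rewrite in_itv/= => cxy cE; exists c.
suff : K m <= K s by rewrite /K mulrBr opprB addrA lerBlDr.
have [sm|ms|<-//] := ltgtP s m.
- have [c /andP[sc cm] E] := mvt s m s0 sm.
  rewrite -subr_le0 E; apply: mulr_le0_ge0; last by rewrite subr_ge0 ltW.
  rewrite subr_le0.
  rewrite ler_pdivlMr ?tail_weight_gt0 ?(lt_trans s0)// mul1r.
  by rewrite tail_weight_ndecr ?(ltW cm)// (le_trans s1s)// ltW.
- have [c /andP[mc cs] E] := mvt m s m0 ms.
  rewrite -subr_ge0 E; apply: mulr_ge0; last by rewrite subr_ge0 ltW.
  rewrite subr_ge0.
  rewrite ler_pdivrMr ?tail_weight_gt0 ?(lt_trans m0)// mul1r.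
  by rewrite tail_weight_ndecr// ltW.
Qed.

End power.

End tail_integral.

(** * Integrability of a power singularity *)

Section singular_integral.
Context (R : realType).

(** Monotonicity for arbitrary nonnegative integrands: the integral is a
    supremum over simple functions. With the integrand restricted by zero,
    it applies to integrals over arbitrary sets. *)
Lemma ge0_le_integral_nonmeasurable d (X : measurableType d)
    (mu : {measure set X -> \bar R}) (h1 h2 : X -> \bar R) :
  (forall x, 0 <= h1 x)%E -> (forall x, h1 x <= h2 x)%E ->
  (\int[mu]_x h1 x <= \int[mu]_x h2 x)%E.
Proof.
move=> h10 h12; have h20 x : (0 <= h2 x)%E by exact: le_trans (h12 x).
rewrite !ge0_integralTE//; apply/ereal_supP => _ [h hh1 <-].
by apply: ereal_sup_ubound; exists h => // x; exact: le_trans (hh1 x) (h12 x).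
Qed.

Lemma dyadic_scale (y p : R) : 0 < p <= y ->
  exists k, y * 4^-1 ^+ k.+1 < p <= y * 4^-1 ^+ k.
Proof.
move=> /andP[p0 py]; have y0 := lt_le_trans p0 py.
have ex : exists k, y * 4^-1 ^+ k.+1 < p.
  exists (Num.truncn (y / p)).
  rewrite exprVn ltr_pdivrMr ?exprn_gt0// -ltr_pdivrMl// mulrC.
  apply: lt_trans (truncnS_gt _) _.
  by rewrite -natrX ltr_nat ltn_expl.
case: (ex_minnP ex) => k kp kmin; exists k; rewrite kp/=.
case: k kmin {kp} => [_|k kmin]; first by rewrite expr0 mulr1.
by rewrite leNgt; apply/negP => /kmin; rewrite ltnn.
Qed.

(** A function that is bounded by [|x|^(-2 gam)] near the origin is at most
    [c_k] on the dyadic shell inside the box of half-width [e_k]; the volume of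
    that box makes the series of the [c_k (2 e_k)^N] geometric with ratio
    [2^(2 gam - N) < 1]. The bound depends on the domain only through the size
    of a box that contains it, hence is uniform over balls of a given radius. *)
Lemma singular_integral_bound n (C y1 gam : R) (g : 'rV[R]_n.+1 -> R) :
  0 <= C -> 0 < y1 -> 0 <= gam -> 2 * gam < n.+1%:R ->
  (forall x, 0 <= g x) ->
  (forall x, 0 < enorm x ^+ 2 <= y1 -> g x <= (enorm x ^+ 2) `^ (- gam)) ->
  (forall x, ~~ (0 < enorm x ^+ 2 <= y1) -> g x <= C) ->
  exists S : R, forall (D : set 'rV[R]_n.+1) a rho, 0 <= rho -> D `<=` box a rho ->
    (\int[lebesgue_rV R n.+1]_(x in D) `|(g x)%:E| <= (C * (2 * rho) ^+ n.+1 + S)%:E)%E.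
Proof.
move=> C0 y10 gam0 gamN g0 gsing greg.
pose e k : R := Num.sqrt y1 * 2^-1 ^+ k.
pose c k := (y1 * 4^-1 ^+ k.+1) `^ (- gam).
have e0 k : 0 <= e k by rewrite mulr_ge0 ?sqrtr_ge0// exprn_ge0// invr_ge0.
have c0 k : 0 <= c k by exact: powR_ge0.
have e2 k : e k ^+ 2 = y1 * 4^-1 ^+ k.
  rewrite exprMn sqr_sqrtr ?ltW// -exprM mulnC exprM; congr (_ * _ ^+ _).
  by rewrite exprVn -natrX.
(* [w] is the ratio of the [c k], and [z] that of the integrals over the boxes. *)
pose w : R := 4 `^ gam.
pose z := w * 2^-1 ^+ n.+1.
have w0 : 0 < w by rewrite powR_gt0.
have z0 : 0 < z by rewrite mulr_gt0// exprn_gt0// invr_gt0.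
have z1 : z < 1.
  rewrite /z exprVn ltr_pdivrMr ?exprn_gt0// mul1r.
  have -> : w = 2 `^ (2 * gam) by rewrite powRrM powR_mulrn// -natrX.
  have -> : (2 : R) ^+ n.+1 = 2 `^ (2 * gam) * 2 `^ (n.+1%:R - 2 * gam).
    rewrite -powRD; last by apply/implyP => _; rewrite gt_eqF.
    by rewrite addrC subrK powR_mulrn.
  rewrite -[ltLHS]mulr1 ltr_pM2l ?powR_gt0//.
  have E1 : (1 : R) `^ (n.+1%:R - 2 * gam) = 1 by rewrite powR1.
  rewrite -[ltLHS]E1.
  by apply: gt0_ltr_powR; rewrite ?nnegrE ?subr_gt0// ltr1n.
pose a0 := y1 `^ (- gam) * w * (2 * Num.sqrt y1) ^+ n.+1.
have cE k : c k * (2 * e k) ^+ n.+1 = a0 * z ^+ k.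
  have q0 : (0 : R) <= 4^-1 by rewrite invr_ge0.
  have wE : (4^-1 : R) `^ (- gam) = w.
    by rewrite -powR_inv1// -powRrM mulN1r opprK.
  have qE : (4^-1 ^+ k.+1) `^ (- gam) = w ^+ k.+1.
    by rewrite -(powR_mulrn _ q0) powRAC wE powR_mulrn// ltW.
  rewrite /c powRM ?exprn_ge0 ?(ltW y10)// qE /e /a0 /z.
  rewrite mulrA !exprMn -!exprM [(n.+1 * k)%N]mulnC exprS; ring.
exists (a0 * (1 - z)^-1) => D a rho rho0 Da.
pose H x := ((C * \1_(box a rho) x)%:E +
  \sum_(0 <= k <oo) (c k * \1_(box 0 (e k)) x)%:E)%E.
have mind (b : R) (A : set 'rV[R]_n.+1) : measurable A ->
    measurable_fun setT (fun x : 'rV[R]_n.+1 => (b * \1_A x)%:E).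
  by move=> mA; apply/measurable_EFinP; apply: measurable_funM.
have ind0 (b : R) (A : set 'rV[R]_n.+1) x : 0 <= b -> (0 <= (b * \1_A x)%:E)%E.
  by move=> b0; rewrite lee_fin mulr_ge0.
have intind (b : R) a' e' : 0 <= b -> 0 <= e' ->
    (\int[lebesgue_rV R n.+1]_x (b * \1_(box a' e') x)%:E = (b * (2 * e') ^+ n.+1)%:E)%E.
  move=> b0 e'0; have mB := measurable_box a' e'.
  under eq_integral do rewrite EFinM.
  rewrite ge0_integralZl//; last by apply/measurable_EFinP; exact: measurable_indic.
  rewrite integral_indic// setIT EFinM; congr (_ * _)%E; exact: measure_box.
have S0 x : (0 <= \sum_(0 <= k <oo) (c k * \1_(box 0%R (e k)) x)%:E)%E.
  by apply: nneseries_ge0 => k _ _; rewrite lee_fin mulr_ge0.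
rewrite integral_mkcond; apply: (@le_trans _ _ (\int[lebesgue_rV R n.+1]_x H x)%E).
  apply: ge0_le_integral_nonmeasurable => x.
    by rewrite patchE; case: ifP.
  rewrite patchE; case: ifPn => [xD|_]; last by rewrite adde_ge0// ind0.
  rewrite gee0_abs ?lee_fin//.
  have [px|npx] := boolP (0 < enorm x ^+ 2 <= y1); last first.
    apply: (@le_trans _ _ (C * \1_(box a rho) x)%:E).
      rewrite indicE mem_set ?mulr1 ?lee_fin ?greg//.
      by apply: Da; exact/set_mem.
    by rewrite leeDl.
  have [k /andP[kp pk]] := dyadic_scale px.
  apply: (@le_trans _ _ (c k * \1_(box 0 (e k)) x)%:E).
    rewrite indicE mem_set ?mulr1.
      rewrite lee_fin (le_trans (gsing x px))// /c !powRN.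
      have ? : 0 < y1 * 4^-1 ^+ k.+1 by rewrite mulr_gt0// exprn_gt0// invr_gt0.
      rewrite lef_pV2 ?posrE ?powR_gt0//; last by case/andP: px.
      by rewrite ge0_ler_powR ?nnegrE ?sqr_ge0 ?(ltW kp)// ltW.
    move=> i; rewrite mxE subr0 (le_trans (coord_le_enorm x i))//.
    by rewrite -(@ler_pXn2r _ 2)// ?nnegrE ?enorm_ge0// e2.
  apply: (@le_trans _ _ (\sum_(0 <= k <oo) (c k * \1_(box 0%R (e k)) x)%:E)%E).
    rewrite (@nneseriesD1 _ _ k)// => [|i _]; last exact: ind0.
    by rewrite leeDl// nneseries_ge0// => i _ _; exact: ind0.
  by rewrite leeDr// ind0.
rewrite ge0_integralD//; last 3 first.
- by move=> x _; exact: ind0.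
- by apply: mind; exact: measurable_box.
- apply: ge0_emeasurable_sum => [k x _ _|k _]; first exact: ind0.
  by apply: mind; exact: measurable_box.
rewrite intind// integral_nneseries//; last 2 first.
- by move=> k; apply: mind; exact: measurable_box.
- by move=> k x _; exact: ind0.
rewrite EFinD leeD2l//.
under eq_eseriesr do rewrite intind// cE.
apply: lime_le.
  by apply: is_cvg_nneseries => k _ _; rewrite lee_fin mulr_ge0// ?exprn_ge0 ?(ltW z0)// !mulr_ge0 ?powR_ge0 ?exprn_ge0 ?mulr_ge0 ?sqrtr_ge0.
apply: nearW => k; rewrite sumEFin lee_fin.
apply: geometric_le_lim => //.
  by rewrite mulr_ge0 ?exprn_ge0 ?mulr_ge0 ?sqrtr_ge0 ?powR_ge0 ?(ltW w0).
by rewrite gtr0_norm.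
Qed.

End singular_integral.

(** * The singular initial value *)

Section initial_profile.
Context (R : realType) (f : R -> R).
Hypothesis fC1 : C1_nonneg f.
Hypothesis f_gt0 : forall s : R, 0 < s -> 0 < f s.
Hypothesis F_fin : forall s : R, 0 < s -> (bigF f s < +oo)%E.
Local Notation F := (tailF f).
Variables (beta s1 : R).
Hypothesis beta_gt0 : 0 < beta.
Hypothesis s1_gt0 : 0 < s1.

(** The inverse function of [tailF ^ beta] on [[s1, +oo[], extended by the
    constant [s1] outside its domain; in particular [profile 0 = s1], a
    conventional value at the point where the initial function is singular. *)
Definition profile (p : R) : R := xget s1 [set s | s1 <= s /\ F s `^ beta = p].

Lemma tailF_powR_decr s t : 0 < s -> s < t -> F t `^ beta < F s `^ beta.
Proof.
move=> s0 st; have t0 := lt_trans s0 st.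
by apply: gt0_ltr_powR; rewrite ?nnegrE ?ltW ?(tailF_decr fC1)// tailF_gt0.
Qed.

Lemma profileP p : 0 < p <= F s1 `^ beta ->
  s1 <= profile p /\ F (profile p) `^ beta = p.
Proof.
move=> /andP[p0 ps1].
suff [s sP] : exists s, s1 <= s /\ F s `^ beta = p
  by exact: (@xgetI _ s1 [set s | s1 <= s /\ F s `^ beta = p] s sP).
have q0 : 0 < p `^ beta^-1 by rewrite powR_gt0.
have [M s1M FM] := tailF_small fC1 f_gt0 F_fin s1_gt0 q0.
have M0 := lt_le_trans s1_gt0 s1M.
have FMp : F M `^ beta <= p.
  have -> : p = (p `^ beta^-1) `^ beta.
    by rewrite -powRrM mulVf ?gt_eqF// powRr1// ltW.
  by rewrite ge0_ler_powR ?nnegrE ?ltW// tailF_gt0.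
have cF : {within `[s1, M], continuous (fun s => F s `^ beta)}.
  apply: derivable_within_continuous => x; rewrite in_itv/= => /andP[s1x _].
  by case: (is_derive_tailF_powR fC1 f_gt0 F_fin beta (lt_le_trans s1_gt0 s1x)).
have [|s] := @IVT _ (fun s => F s `^ beta) s1 M p s1M cF.
  have minmax (a c : R) : a <= p -> p <= c -> Num.min c a <= p <= Num.max c a.
    by move=> ap pc; rewrite ge_min ap orbT le_max pc.
  exact: minmax.
by rewrite in_itv/= => /andP[s1s _] Fs; exists s.
Qed.

Lemma profile_default p : ~~ (0 < p <= F s1 `^ beta) -> profile p = s1.
Proof.
move=> /negP pn; apply: xgetPN => s [s1s Fs]; apply: pn.
rewrite -Fs powR_gt0 ?tailF_gt0 ?(lt_le_trans s1_gt0)//=.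
have [->//|ss1] := eqVneq s s1.
by rewrite ltW// tailF_powR_decr// lt_neqAle eq_sym ss1.
Qed.

Lemma profile_ge p : s1 <= profile p.
Proof.
have [/profileP[]//|/profile_default ->//] := boolP (0 < p <= F s1 `^ beta).
Qed.

Lemma profile_gt0 p : 0 < profile p.
Proof. exact: lt_le_trans (profile_ge p). Qed.

Lemma measurable_profile : measurable_fun setT profile.
Proof.
apply: (measurability (@RGenOInfty.G R)) => [|/= _ [_] [c] -> <-].
  exact: RGenOInfty.measurableE.
apply: measurableI => //.
have [cs1|s1c] := ltP c s1.
  rewrite (_ : _ @^-1` _ = setT)//; apply/seteqP; split => // p _ /=.
  by rewrite in_itv/= andbT (lt_le_trans cs1)// profile_ge.
rewrite (_ : _ @^-1` _ = `]0, F c `^ beta[%classic)//.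
have c0 := lt_le_trans s1_gt0 s1c.
have Fcs1 : F c `^ beta <= F s1 `^ beta.
  have [->//|cs1] := eqVneq c s1.
  by rewrite ltW// tailF_powR_decr// lt_neqAle eq_sym cs1.
apply/seteqP; split => p /=; rewrite !in_itv/= ?andbT.
  move=> cp; have [pin|/profile_default E] := boolP (0 < p <= F s1 `^ beta).
    have [_ {2}<-] := profileP pin; case/andP: pin => -> _ /=.
    exact: tailF_powR_decr.
  by move: cp; rewrite E ltNge s1c.
move=> /andP[p0 pc]; have [|_ E] := @profileP p; first by rewrite p0 (le_trans (ltW pc)).
rewrite ltNge; apply/negP => pc'.
suff : F c `^ beta <= F (profile p) `^ beta by rewrite E leNgt pc.
have [->//|pc_neq] := eqVneq (profile p) c.
by rewrite ltW// tailF_powR_decr ?profile_gt0// lt_neqAle pc_neq.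
Qed.

Lemma bigF_negpow_tailF r s : 0 < s -> bigF_negpow f r s = F s `^ (- r).
Proof. by move=> s0; rewrite /bigF_negpow bigF_tailF. Qed.

Lemma measurable_bigF_negpow_profile r :
  measurable_fun setT (fun p => bigF_negpow f r (profile p)).
Proof.
rewrite (_ : (fun _ => _) = (fun s => F s `^ (- r)) \o profile); last first.
  by apply/funext => p /=; rewrite bigF_negpow_tailF// profile_gt0.
apply: (@measurable_comp _ _ _ _ _ _ (`]0, +oo[%classic : set R)) => //.
- by move=> _ [p _ <-] /=; rewrite in_itv/= andbT profile_gt0.
- apply: open_continuous_measurable_fun; first exact: interval_open.
  move=> s; rewrite inE/= in_itv/= andbT => s0.
  apply: differentiable_continuous; apply/derivable1_diffP.
  by case: (is_derive_tailF_powR fC1 f_gt0 F_fin (- r) s0).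
- exact: measurable_profile.
Qed.

(** Near the origin the function is [|x|^(-2 r / beta)], and it is constant
    further out. *)
Lemma bigF_negpow_profile_L1ul n r rho : 0 < rho -> 0 < r ->
  2 * (r / beta) < n.+1%:R ->
  L1ul rho (fun x : 'rV[R]_n.+1 => bigF_negpow f r (profile (enorm x ^+ 2))).
Proof.
move=> rho0 r0 rN; set g := fun x => _.
pose C := F s1 `^ (- r).
have gE x : g x = F (profile (enorm x ^+ 2)) `^ (- r).
  by rewrite /g bigF_negpow_tailF// profile_gt0.
have [||||x|x px|x px|S gS] :=
  @singular_integral_bound R n C (F s1 `^ beta) (r / beta) g.
- exact: powR_ge0.
- by rewrite powR_gt0// tailF_gt0.
- by rewrite divr_ge0 ?ltW.
- exact: rN.
- by rewrite gE powR_ge0.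
- have [_ <-] := profileP px; rewrite gE -powRrM.
  by rewrite mulrN mulrCA mulfV ?gt_eqF// mulr1.
- by rewrite gE profile_default.
split; first split.
- apply: (@measurableT_comp _ _ _ _ _ _ (fun p => bigF_negpow f r (profile p))).
    exact: measurable_bigF_negpow_profile.
  apply: measurable_funX; exact: measurable_enorm.
- move=> K cK; have [->|/set0P K0] := eqVneq K set0; first by rewrite integral_set0 ltry.
  have [|c _ cmax] := @compact_EVT_max _ _ (fun x : 'rV[R]_n.+1 => enorm x ^+ 2) K K0 cK.
    exact/continuous_subspaceT/continuous_enorm_sqr.
  apply: le_lt_trans (ltry _); apply: (gS _ 0 (enorm c)); first exact: enorm_ge0.
  move=> x /mem_set /cmax xc i; rewrite mxE subr0 (le_trans (coord_le_enorm x i))//.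
  by rewrite -(@ler_pXn2r _ 2)// ?nnegrE ?enorm_ge0.
- apply: le_lt_trans (ltry (C * (2 * rho) ^+ n.+1 + S)).
  apply/ereal_supP => _ [y _ <-]; apply: (gS _ y); first exact: ltW.
  move=> x xy i; apply: ltW; apply: le_lt_trans xy.
  by have := coord_le_enorm (x - y) i; rewrite !mxE.
Qed.

End initial_profile.

(** The inverse of a decreasing convex function is convex, and stays so when
    it is continued by its final value; hence it lies above all its tangents.
    With [p = |x|^2] this bounds the initial function from below by a
    concave quadratic polynomial on the whole space, the origin excepted. *)
Lemma profile_quadratic_ge (R : realType) (f : R -> R) (beta s1 : R) :
  C1_nonneg f -> (forall s : R, 0 < s -> 0 < f s) ->
  (forall s : R, 0 < s -> (bigF f s < +oo)%E) -> 0 < beta < 1 -> 0 < s1 ->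
  (forall s, s1 <= s -> 1 - beta <= derive1 f s * tailF f s) ->
  forall m p, s1 <= m -> 0 < p ->
  m - tail_weight f beta m / beta * (p - tailF f m `^ beta) <= profile f beta s1 p.
Proof.
move=> fC1 f_gt0 F_fin beta01 s10 f'F m p s1m p0.
have b0 : 0 < beta by case/andP: beta01.
have m0 := lt_le_trans s10 s1m.
have sge := @profile_ge R f fC1 f_gt0 F_fin beta s1 b0 s10 p.
apply: le_trans (tailF_powR_tangent fC1 f_gt0 F_fin beta01 s10 f'F sge s1m).
rewrite lerD2l lerN2 ler_wpM2l//.
  by rewrite divr_ge0 ?(ltW b0)// ltW// (tail_weight_gt0 fC1 f_gt0 F_fin).
rewrite lerD2r.
have [pin|pout] := boolP (0 < p <= tailF f s1 `^ beta).
  by have [_ ->] := profileP fC1 f_gt0 F_fin b0 s10 pin.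
rewrite (profile_default fC1)// ltW//.
by move: pout; rewrite p0/= -ltNge.
Qed.

(** * The heat flow from below *)

Section heat_lower_bound.
Context (R : realType).
Local Notation mu := (lebesgue_rV R).

Lemma enorm_sqr_le n (x y : 'rV[R]_n) :
  enorm y ^+ 2 <= 2 * enorm x ^+ 2 + 2 * enorm (x - y) ^+ 2.
Proof.
rewrite !enorm_sqr !mulr_sumr -big_split/=; apply: ler_sum => i _.
rewrite !mxE; set a := x ord0 i; set b := y ord0 i.
have := sqr_ge0 (2 * a - b); nra.
Qed.

Lemma mul_expRN_le (s : R) : 0 <= s -> s * expR (- s) <= expR (- (s / 2)).
Proof.
move=> s0; have -> : expR (- s) = expR (- (s / 2)) * expR (- (s / 2)).
  by rewrite -expRD; congr expR; lra.
have e0 := expR_gt0 (- (s / 2)).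
rewrite mulrA -[leRHS]mul1r ler_pM2r// expRN ler_pdivrMr ?expR_gt0// mul1r.
have h : 0 <= s / 4 by rewrite divr_ge0.
have -> : s / 2 = s / 4 + s / 4 by lra.
rewrite expRD; have h1 := expR_ge1Dx (s / 4).
have := sqr_ge0 (1 - s / 4).
have h2 : 0 <= expR (s / 4) - (1 + s / 4) by lra.
nra.
Qed.

(** An upper bound for [1/t] times the contribution of [2 |x - y|^2] to the
    Gaussian mean of [|y|^2]. The sharp constant [4 n] would require second
    moments; [mul_expRN_le] trades the factor [|x - y|^2] for a Gaussian of
    twice the variance, whose mass is known. *)
Definition gauss_spread n : R := 8 * Num.sqrt 2 ^+ n.

Lemma gauss_spread_gt0 n : 0 < gauss_spread n.
Proof. by rewrite mulr_gt0// exprn_gt0// sqrtr_gt0. Qed.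

Lemma measurable_gauss_rV n (x : 'rV[R]_n) (d : R) :
  measurable_fun setT (fun y : 'rV[R]_n => expR (- (enorm (x - y) ^+ 2 / d))).
Proof.
apply: measurableT_comp => //; apply: measurableT_comp => //.
apply: measurable_funM => //; apply: measurable_funX.
apply: (@measurableT_comp _ _ _ _ _ _ (@enorm R n)).
  exact: measurable_enorm.
exact: measurable_sub_rV.
Qed.

(** Integrate the quadratic lower bound for [phi] against the heat kernel. All
    negative terms are moved to the other side, so that only integrals of
    nonnegative functions occur and the heat integral may be infinite. *)
Lemma heat_quadratic_ge n (t A sigma : R) (phi : 'rV[R]_n.+1 -> R) x :
  0 < t -> 0 <= A -> 0 <= sigma ->
  measurable_fun setT phi -> (forall y, 0 <= phi y) ->
  (forall y, y != 0 -> A - sigma * enorm y ^+ 2 <= phi y) ->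
  ((A - sigma * (2 * enorm x ^+ 2 + gauss_spread n.+1 * t))%:E <= heat t phi x)%E.
Proof.
move=> t0 A0 sg0 mphi phi0 phiA.
pose e (y : 'rV[R]_n.+1) := expR (- (enorm (x - y) ^+ 2 / (4 * t))).
pose e2 (y : 'rV[R]_n.+1) := expR (- (enorm (x - y) ^+ 2 / (8 * t))).
have t4 : 0 < 4 * t by rewrite mulr_gt0.
have t8 : 0 < 8 * t by rewrite mulr_gt0.
pose G := Num.sqrt (pi * (4 * t)) ^+ n.+1.
have G0 : 0 < G by rewrite exprn_gt0// sqrtr_gt0 mulr_gt0// pi_gt0.
have intE : (\int[mu n.+1]_y (e y)%:E = G%:E)%E by exact: integral_gauss_rV.
have intE2 : (\int[mu n.+1]_y (e2 y)%:E = (Num.sqrt 2 ^+ n.+1 * G)%:E)%E.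
  rewrite integral_gauss_rV// /G -exprMn -sqrtrM//; congr ((Num.sqrt _ ^+ _)%:E).
  by ring.
have me : measurable_fun setT e by exact: measurable_gauss_rV.
have me2 : measurable_fun setT e2 by exact: measurable_gauss_rV.
have e0 y : 0 <= e y by exact: expR_ge0.
have e20 y : 0 <= e2 y by exact: expR_ge0.
have key (y : 'rV[R]_n.+1) : y != 0 ->
    A * e y <= e y * phi y + (2 * sigma * enorm x ^+ 2 * e y + 8 * sigma * t * e2 y).
  move=> /phiA phiy.
  have h1 : enorm (x - y) ^+ 2 * e y <= 4 * t * e2 y.
    have s0 : 0 <= enorm (x - y) ^+ 2 / (4 * t).
      by rewrite divr_ge0 ?sqr_ge0// ltW.
    have := mul_expRN_le s0.
    rewrite -/(e y) (_ : expR _ = e2 y).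
      by rewrite mulrAC ler_pdivrMr// [e2 y * _]mulrC.
    by rewrite /e2; congr (expR (- _)); field; rewrite gt_eqF.
  have h2 := enorm_sqr_le x y.
  have h3 : A * e y <= (phi y + sigma * enorm y ^+ 2) * e y.
    by rewrite ler_wpM2r//; lra.
  have h4 : sigma * enorm y ^+ 2 * e y <=
      sigma * (2 * enorm x ^+ 2 + 2 * enorm (x - y) ^+ 2) * e y.
    by rewrite ler_wpM2r// ler_wpM2l.
  have h5 : sigma * (enorm (x - y) ^+ 2 * e y) <= sigma * (4 * t * e2 y).
    by rewrite ler_wpM2l.
  nra.
pose I := (\int[mu n.+1]_y (e y * phi y)%:E)%E.
have mephi : measurable_fun setT (fun y : 'rV[R]_n.+1 => e y * phi y) by exact: measurable_funM.
have ineq : ((A * G)%:E <=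
    I + (2 * sigma * enorm x ^+ 2 * G + 8 * sigma * t * (Num.sqrt 2 ^+ n.+1 * G))%:E)%E.
  have c1 : 0 <= 2 * sigma * enorm x ^+ 2 by rewrite mulr_ge0 ?sqr_ge0// mulr_ge0.
  have c2 : 0 <= 8 * sigma * t by rewrite mulr_ge0 ?(ltW t0)// mulr_ge0.
  rewrite EFinM -intE -ge0_integralZl//; last 2 first.
  - exact/measurable_EFinP.
  - by move=> y _; rewrite lee_fin.
  rewrite EFinD [X in (_ + (X + _))%E]EFinM [X in (_ + (_ + X))%E]EFinM.
  rewrite -intE -intE2 -ge0_integralZl//; last 2 first.
  - exact/measurable_EFinP.
  - by move=> y _; rewrite lee_fin.
  rewrite -ge0_integralZl//; last 2 first.
  - exact/measurable_EFinP.
  - by move=> y _; rewrite lee_fin.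
  rewrite -ge0_integralD//; last 4 first.
  - by move=> y _; rewrite lee_fin mulr_ge0.
  - by apply/measurable_EFinP; exact: measurable_funM.
  - by move=> y _; rewrite lee_fin mulr_ge0.
  - by apply/measurable_EFinP; exact: measurable_funM.
  rewrite /I -ge0_integralD//; last 4 first.
  - by move=> y _; rewrite lee_fin mulr_ge0.
  - exact/measurable_EFinP.
  - by move=> y _; rewrite lee_fin addr_ge0// mulr_ge0.
  - by apply/measurable_EFinP; apply: measurable_funD; exact: measurable_funM.
  apply: ae_ge0_le_integral => //.
  - by move=> y _; rewrite lee_fin mulr_ge0.
  - by apply/measurable_EFinP; exact: measurable_funM.
  - by move=> y _; rewrite lee_fin !addr_ge0// mulr_ge0.
  - apply/measurable_EFinP; apply: measurable_funD => //.
    by apply: measurable_funD; exact: measurable_funM.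
  - exists [set 0]; split; first by rewrite -box0; exact: measurable_box.
      exact: measure_set1_rV.
    move=> y /= /not_implyP[_ /negP]; rewrite -ltNge => yA.
    apply/eqP; apply/negPn/negP => /key; rewrite leNgt => /negP; apply.
    by move: yA; rewrite lte_fin.
have heatE : heat t phi x = ((G^-1)%:E * I)%E.
  rewrite /heat /I; congr (_%:E * _)%E.
  rewrite powRN /G; congr (_^-1).
  have -> : 4 * pi * t = pi * (4 * t) by ring.
  have p0 : 0 <= pi * (4 * t) by rewrite mulr_ge0 ?pi_ge0 ?(ltW t4).
  by rewrite [_%:R / 2]mulrC powRrM powR12_sqrt// powR_mulrn// sqrtr_ge0.
have I0 : (0 <= I)%E by apply: integral_ge0 => y _; rewrite lee_fin mulr_ge0.
rewrite {}heatE; case: I ineq I0 => [J| |]//= ineq I0.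
  rewrite -EFinM lee_fin [G^-1 * J]mulrC ler_pdivlMr//.
  move: ineq; rewrite -EFinD lee_fin /gauss_spread; nra.
by rewrite gt0_muley ?leey// lte_fin invr_gt0.
Qed.

End heat_lower_bound.

(** * Comparison of solutions with quadratic polynomials *)

Section comparison.
Context (R : realType) (n : nat) (f : R -> R).
Context (u0 : 'rV[R]_n.+1 -> R) (T : R) (u : 'rV[R]_n.+1 -> R -> R).
Hypothesis usol : nonneg_classical_solution f u0 T u.
Local Notation mu := (lebesgue_rV R n.+1).

(** The essential supremum of [u - heat] is small at small times, which bounds
    [u - c] from below almost everywhere; as [u - c] is continuous and null sets
    contain no box, the bound holds everywhere. *)
Lemma solution_ge_initially (c : 'rV[R]_n.+1 -> R -> R) (t1 eta : R) :
  0 < t1 <= T -> 0 < eta -> (forall t, continuous (c^~ t)) ->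
  (forall t x, 0 < t -> ((c x t)%:E <= heat t u0 x)%E) ->
  exists2 t0, 0 < t0 < t1 & forall x, c x t0 - eta <= u x t0.
Proof.
move=> /andP[t10 t1T] eta0 cc cheat; have [uC _ _ uinit] := usol.
have small : \forall t \near (0 : R)^'+,
    (Lnorm mu +oo (fun x => (u x t)%:E - heat t u0 x) < eta%:E)%E.
  by apply: (uinit [set z | (z < eta%:E)%E]); apply: open_nbhs_nbhs; split; [exact: open_ereal_lt_ereal|rewrite /= lte_fin].
near (0 : R)^'+ => t0.
have t00 : 0 < t0 by near: t0; exact: nbhs_right_gt.
have t01 : t0 < t1 by near: t0; exact: nbhs_right_lt.
exists t0; first by rewrite t00.
have muT : (0 < mu [set: 'rV[R]_n.+1])%E.
  apply: (@lt_le_trans _ _ (mu (box 0 1))).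
    by rewrite measure_box// lte_fin exprn_gt0// mulr1.
  by apply: le_measure; rewrite ?inE//; exact: measurable_box.
have : (Lnorm mu +oo (fun x => (u x t0)%:E - heat t0 u0 x) < eta%:E)%E by near: t0.
rewrite unlock muT => /ltW/ess_supP uae.
have {}uae : {ae mu, forall x, c x t0 - eta <= u x t0}.
  apply: filterS uae => x /=; have := cheat t0 x t00.
  case: (heat t0 u0 x) => [h| |]//=.
  by rewrite !lee_fin => ch /ler_normlP[]; lra.
move=> x; rewrite leNgt; apply/negP => ult.
have cont : {for x, continuous (fun y => c y t0 - eta - u y t0)}.
  have h5 : (fun=> eta) y @[y --> x] --> eta by exact: cst_continuous.
  have h1 : c y t0 @[y --> x] --> c x t0 := cc t0 x.
  have h2 : u y t0 @[y --> x] --> u x t0.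
    have [|uc _ _ _] := uC x t0; first by rewrite t00 (lt_le_trans t01).
    apply: (@continuous_comp _ _ _ (fun y => (y, t0)) (fun p : 'rV[R]_n.+1 * R => u p.1 p.2)) => //.
    have h3 : y @[y --> x] --> x by exact: cvg_id.
    have h4 : (fun=> t0) y @[y --> x] --> t0 by exact: cst_continuous.
    exact: (cvg_pair h3 h4).
  exact: (cvgB (cvgB h1 h5) h2).
have /cvgrPdist_lt := cont.
have pos : 0 < c x t0 - eta - u x t0 by rewrite subr_gt0.
move=> /(_ _ pos) /nbhs_ballP[e /= e0 near_x].
have e2 : 0 < e / 2 by rewrite divr_gt0.
have [y yB uy] := ae_box_meets uae x e2.
have := near_x y; apply: contraPP => _ /=; apply/not_implyP; split.
  split=> // i j; rewrite (ord1 i) /ball/= distrC (le_lt_trans (yB j))//; lra.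
by apply/negP; rewrite -leNgt; rewrite ger0_norm; lra.
Unshelve. all: by end_near. Qed.

(** The right-hand polynomial is a strict subsolution of the heat equation, and
    it is negative far away, where [u] is nonnegative. At an interior minimum of
    the difference the test of [parabolic_min_test] would give [f u < 0]. *)
Lemma solution_ge_quadratic (A sigma : R) : (forall s, 0 <= s -> 0 <= f s) ->
  0 <= A -> 0 < sigma ->
  measurable_fun setT u0 -> (forall y, 0 <= u0 y) ->
  (forall y, y != 0 -> A - sigma * enorm y ^+ 2 <= u0 y) ->
  forall x t, 0 < t < T ->
  A - sigma * (2 * enorm x ^+ 2 + (gauss_spread R n.+1 + 4 * n.+1%:R) * t) <= u x t.
Proof.
move=> f0 A0 sg0 mu0 u00 u0A x t tT.
have [uC u_ge0 ueq _] := usol.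
pose k : R := gauss_spread R n.+1.
have k0 : 0 < k by exact: gauss_spread_gt0.
rewrite -/k leNgt; apply/negP => ult.
have t0 : 0 < t by case/andP: tT.
pose q (y : 'rV[R]_n.+1) (s : R) := A - sigma * (2 * enorm y ^+ 2 + (k + 4 * n.+1%:R) * s).
pose eta := q x t - u x t.
have eta0 : 0 < eta by rewrite subr_gt0.
have eta2 : 0 < eta / 2 by rewrite divr_gt0.
have t1T : 0 < t <= T by rewrite t0; case/andP: tT => _ /ltW.
pose c (y : 'rV[R]_n.+1) s := A - sigma * (2 * enorm y ^+ 2 + k * s).
have cc s : continuous (c^~ s).
  rewrite (_ : c^~ s = fun y => (A - sigma * (k * s)) + (- (2 * sigma)) * enorm y ^+ 2).
    exact: continuous_quadratic.
  by apply/funext => y; rewrite /c; ring.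
have [s0 /andP[s00 s0t] uge] := solution_ge_initially t1T eta2 cc
  (fun s y s0 => heat_quadratic_ge y s0 A0 (ltW sg0) mu0 u00 u0A).
(* The box contains [x] and reaches out to where the polynomial is negative. *)
pose L := enorm x + A / (2 * sigma) + 1.
have As0 : 0 <= A / (2 * sigma) by rewrite divr_ge0// mulr_ge0// ltW.
have L1 : 1 <= L by rewrite /L; have := enorm_ge0 x; lra.
have LA : A <= 2 * sigma * L ^+ 2.
  have : A / (2 * sigma) <= L ^+ 2.
    apply: (@le_trans _ _ L); last by rewrite expr2 ler_peMl// (le_trans ler01).
    by rewrite /L; have := enorm_ge0 x; lra.
  by rewrite ler_pdivrMr ?mulr_gt0// mulrC.
pose W (p : 'rV[R]_n.+1 * R) := u p.1 p.2 +
  (0 + 2 * sigma * enorm p.1 ^+ 2 + sigma * (k + 4 * n.+1%:R) * p.2).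
have sT s : s0 <= s <= t -> 0 < s < T.
  move=> /andP[s0s st]; rewrite (lt_le_trans s00)//=.
  by rewrite (le_lt_trans st)//; case/andP: tT.
have [||||xb [tb [xbL tbt Wlt Wmin]]] := @box_interior_min R n.+1 W L s0 t (A - eta / 2).
- move=> y s yB st; have [uc _ _ _] := uC y s (sT s st).
  exact: (cvgD uc (@continuous_parabola _ _ _ _ _ (y, s))).
- move=> y yB; rewrite /W/=; have := uge y; rewrite /c.
  have : 0 <= sigma * 4 * n.+1%:R * s0 by rewrite !mulr_ge0// ltW.
  lra.
- move=> y s i yB st yi; rewrite /W/=.
  have uy := u_ge0 y s (sT s st).
  have Ly : L ^+ 2 <= enorm y ^+ 2 by rewrite -yi; exact: coord_sqr_le_enorm.
  have h1 : 0 <= sigma * (k + 4 * n.+1%:R) * s.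
    have /andP[ss _] := sT s st.
    by rewrite mulr_ge0 ?(ltW ss)// mulr_ge0 ?(ltW sg0)// addr_ge0 ?(ltW k0).
  have h2 : 2 * sigma * L ^+ 2 <= 2 * sigma * enorm y ^+ 2.
    by rewrite ler_pM2l// mulr_gt0.
  lra.
- exists x, t; split; last 1 first.
  + by rewrite /W/=; move: eta0; rewrite /eta /q; lra.
  + move=> i; rewrite mxE subr0 (le_trans (coord_le_enorm _ _))// /L; lra.
  + by rewrite lexx ltW.
have tbT : s0 < tb < T.
  case/andP: tbt => -> tbt /=; rewrite (le_lt_trans tbt)//; by case/andP: tT.
have tb0T : 0 < tb < T by apply: sT; case/andP: tbt => /ltW -> ->.
have Wmin' y s : box 0 L y -> s0 <= s <= tb ->
    u xb tb + 2 * sigma * enorm xb ^+ 2 + sigma * (k + 4 * n.+1%:R) * tb <=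
    u y s + 2 * sigma * enorm y ^+ 2 + sigma * (k + 4 * n.+1%:R) * s.
  move=> yB /andP[s0s stb]; have := Wmin y s yB.
  rewrite s0s (le_trans stb); last by case/andP: tbt.
  by move=> /(_ isT); rewrite /W/= !add0r !addrA.
have := parabolic_min_test uC s00 tbT xbL Wmin'.
rewrite (ueq _ _ tb0T).
have := f0 _ (u_ge0 xb tb tb0T).
have : 0 < sigma * k by rewrite mulr_gt0.
lra.
Qed.

End comparison.

(** * Blow-up *)

Section blow_up.
Context (R : realType) (n : nat) (f : R -> R).
Hypothesis fC1 : C1_nonneg f.
Hypothesis f_gt0 : forall s : R, 0 < s -> 0 < f s.
Hypothesis f'_gt0 : forall s : R, 0 < s -> 0 < derive1 f s.
Hypothesis F_fin : forall s : R, 0 < s -> (bigF f s < +oo)%E.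
Context (u0 : 'rV[R]_n.+1 -> R) (T : R) (u : 'rV[R]_n.+1 -> R -> R).
Hypothesis usol : nonneg_classical_solution f u0 T u.
Local Notation F := (tailF f).

(** If [u >= m] on a cylinder then [F u <= F m] there, and formally
    [F u] satisfies [z_t <= lap z - 1]. So it stays below
    [z = F m (1 + |y|^2 / L^2) - (s - t0) / 2], which satisfies
    [z_t > lap z - 1] when [F m] is small compared with [L^2], dominates [F m]
    on the parabolic boundary, and vanishes at the centre at time
    [t0 + 2 F m]; but [F u > 0]. At the minimum of [z - F u] the convexity of
    [F] turns the comparison into one for [u] itself. *)
Lemma no_large_cylinder (m L t0 : R) : 0 < m -> 0 < L -> 0 < t0 ->
  t0 + 2 * F m < T -> 4 * n.+1%:R * F m < L ^+ 2 ->
  ~ (forall y s, box 0 L y -> t0 <= s <= t0 + 2 * F m -> m <= u y s).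
Proof.
move=> m0 L0 t00 tT smallF ularge; have [uC _ ueq _] := usol.
pose z0 := F m; have z00 : 0 < z0 by exact: (tailF_gt0 fC1 f_gt0 F_fin m0).
pose t1 := t0 + 2 * z0.
have L20 : 0 < L ^+ 2 by rewrite exprn_gt0.
pose W (p : 'rV[R]_n.+1 * R) :=
  (z0 + t0 / 2) + z0 / L ^+ 2 * enorm p.1 ^+ 2 + (- 2^-1) * p.2 - F (u p.1 p.2).
have sT s : t0 <= s <= t1 -> 0 < s < T.
  by move=> /andP[ts st]; rewrite (lt_le_trans t00)//= (le_lt_trans st).
have Fu y s : box 0 L y -> t0 <= s <= t1 -> F (u y s) <= z0.
  move=> yB st; have := ularge y s yB st; rewrite le_eqVlt => /predU1P[<-//|mu].
  by rewrite ltW// (tailF_decr fC1 f_gt0 F_fin m0).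
have ugt0 y s : box 0 L y -> t0 <= s <= t1 -> 0 < u y s.
  by move=> yB st; apply: lt_le_trans m0 _; exact: ularge.
have q0 (y : 'rV[R]_n.+1) : 0 <= z0 / L ^+ 2 * enorm y ^+ 2.
  by rewrite mulr_ge0 ?sqr_ge0// divr_ge0// ltW.
have B0 : box 0 L (0 : 'rV[R]_n.+1).
  by move=> i; rewrite subrr normr0 ltW.
have tt1 : t0 <= t1 <= t1 by rewrite lexx andbT lerDl mulr_ge0// ltW.
have [||||xb [tb [xbL tbt Wlt Wmin]]] := @box_interior_min R n.+1 W L t0 t1 0.
- move=> y s yB st; have [uc _ _ _] := uC y s (sT s st).
  have Fc := tailF_continuous fC1 f_gt0 F_fin (ugt0 y s yB st).
  have FuC : {for (y, s), continuous (fun p => F (u p.1 p.2))}.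
    exact: (@continuous_comp _ _ _ (fun p => u p.1 p.2) F (y, s) uc Fc).
  exact: (cvgB (@continuous_parabola _ _ _ _ _ (y, s)) FuC).
- move=> y yB; have t0t : t0 <= t0 <= t1 by rewrite lexx; case/andP: tt1.
  by rewrite /W/=; have := Fu y t0 yB t0t; have := q0 y; lra.
- move=> y s i yB st yi; have Fus := Fu y s yB st; rewrite /W/=.
  have : z0 <= z0 / L ^+ 2 * enorm y ^+ 2.
    rewrite mulrAC ler_pdivlMr// ler_pM2l// -yi; exact: coord_sqr_le_enorm.
  by move: st; rewrite /t1 => /andP[]; lra.
- exists 0, t1; split => //.
  have := tailF_gt0 fC1 f_gt0 F_fin (ugt0 0 t1 B0 tt1).
  rewrite /W/= (_ : enorm (0 : 'rV[R]_n.+1) ^+ 2 = 0); last first.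
    by rewrite enorm_sqr big1// => i _; rewrite mxE expr0n.
  by rewrite /t1; lra.
have tbT : t0 < tb < T by case/andP: tbt => -> tbt /=; exact: le_lt_trans tT.
have tb01 : t0 <= tb <= t1 by case/andP: tbt => /ltW -> ->.
have tb0T := sT _ tb01.
have xbB : box 0 L xb by move=> i; rewrite mxE subr0 ltW.
have ub0 := ugt0 xb tb xbB tb01.
pose g := f (u xb tb); have g0 : 0 < g by exact: f_gt0.
(* Multiplying the minimality of [z - F u] by [f] at the minimum and bounding
   [F u] below by its tangent gives minimality of [u + f z]. *)
have Wmin' y s : box 0 L y -> t0 <= s <= tb ->
    u xb tb + g * (z0 / L ^+ 2) * enorm xb ^+ 2 + (- (g / 2)) * tb <=
    u y s + g * (z0 / L ^+ 2) * enorm y ^+ 2 + (- (g / 2)) * s.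
  move=> yB /andP[t0s stb].
  have st1 : t0 <= s <= t1 by rewrite t0s (le_trans stb)//; case/andP: tbt.
  have := Wmin y s yB st1.
  have := tailF_tangent fC1 f_gt0 f'_gt0 F_fin (ugt0 y s yB st1) ub0.
  rewrite -/g lerBlDr -lerBlDl ler_pdivlMr// => tang.
  rewrite /W/= -(ler_pM2l g0); nra.
have := parabolic_min_test uC t00 tbT xbL Wmin'.
rewrite (ueq _ _ tb0T) -/g.
have : 2 * n.+1%:R * (z0 / L ^+ 2) < 2^-1.
  by rewrite mulrA ltr_pdivrMr//; move: smallF; rewrite -/z0; lra.
nra.
Qed.

End blow_up.

(** * Nonexistence *)

(** Since [beta < 1], [z] is negligible with respect to [z ^ beta]. *)
Lemma small_exponents (R : realType) (beta M c : R) : 0 < beta < 1 ->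
  0 < M -> 0 < c -> exists2 e : R, 0 < e & forall z, 0 < z -> z < e ->
    M * z <= z `^ beta /\ z `^ beta < c.
Proof.
move=> /andP[b0 b1] M0 c0; have b10 : 0 < 1 - beta by rewrite subr_gt0.
exists (Num.min (M^-1 `^ (1 - beta)^-1) (c `^ beta^-1)).
  by rewrite lt_min !powR_gt0 ?invr_gt0.
have lt_root (a d z : R) : 0 < a -> 0 < d -> 0 < z -> z < d `^ a^-1 -> z `^ a < d.
  move=> a0 d0 z0 zd.
  have -> : d = (d `^ a^-1) `^ a by rewrite -powRrM mulVf ?gt_eqF// powRr1// ltW.
  by apply: gt0_ltr_powR; rewrite ?nnegrE ?powR_ge0// ltW.
move=> z z0; rewrite lt_min => /andP[z1 z2]; split; last exact: lt_root.
have zb : z = z `^ (1 - beta) * z `^ beta.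
  rewrite -powRD; last by apply/implyP => _; rewrite gt_eqF.
  by rewrite subrK powRr1// ltW.
have zM : z `^ (1 - beta) < M^-1 by apply: lt_root; rewrite ?invr_gt0.
rewrite {1}zb mulrA -[leRHS]mul1r ler_pM2r ?powR_gt0//.
by rewrite mulrC -ler_pdivlMr// mul1r ltW.
Qed.

Theorem theorem1p3 (R : realType) (N : nat) (rho : R) (f : R -> R)
    (hN : (1 <= N)%N) (hrho : 0 < rho)
    (hf : C1_nonneg f)
    (hfpos : forall s : R, 0 < s -> 0 < f s)
    (hf'pos : forall s : R, 0 < s -> 0 < derive1 f s)
    (hF : forall s : R, 0 < s -> (bigF f s < +oo)%E)
    (hA : ((derive1 f s)%:E * bigF f s)%E @[s --> +oo%R] --> 1%E)
    (hs3 : exists2 s3 : R, 0 < s3 &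
       forall s : R, s3 <= s -> ((derive1 f s)%:E * bigF f s <= 1)%E) :
  forall r : R, 0 < r < N%:R / 2 ->
  exists u0 : 'rV[R]_N -> R,
    [/\ forall x, 0 <= u0 x,
        measurable_fun setT u0,
        L1ul rho (fun x => bigF_negpow f r (u0 x)) &
        forall T : R, 0 < T ->
          ~ exists u : 'rV[R]_N -> R -> R, nonneg_classical_solution f u0 T u].
Proof.
case: N hN => // n _ r /andP[r0 rN].
have N0 : (0 : R) < n.+1%:R by rewrite ltr0n.
(* [beta] is the midpoint of the interval from [2 r / N] to [1]. *)
pose q : R := 2 * r / n.+1%:R.
have q1 : q < 1 by rewrite ltr_pdivrMr//; lra.
have q0 : 0 < q by rewrite divr_gt0// mulr_gt0.
pose beta := (1 + q) / 2.
have beta01 : 0 < beta < 1 by rewrite /beta; apply/andP; split; lra.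
have b0 : 0 < beta by case/andP: beta01.
have [s1 s10 f'F] : exists2 s1, 0 < s1 &
    forall s, s1 <= s -> 1 - beta <= derive1 f s * tailF f s.
  have : \forall s \near +oo%R, ((1 - beta)%:E < (derive1 f s)%:E * bigF f s)%E.
    apply: (hA [set z | ((1 - beta)%:E < z)%E]).
    apply: open_nbhs_nbhs; split; first exact: open_ereal_gt_ereal.
    by rewrite /= lte_fin; move: b0; lra.
  move=> [M [_ HM]]; exists (Num.max M 0 + 1).
    by rewrite ltr_wpDl// le_max lexx orbT.
  move=> s Ms; have : M < s /\ 0 < s.
    have h1 : M <= Num.max M 0 by rewrite le_max lexx.
    have h2 : 0 <= Num.max M 0 by rewrite le_max lexx orbT.
    by move: Ms; split; lra.
  by move=> [/HM Ms' s0]; move: Ms'; rewrite bigF_tailF// -EFinM lte_fin => /ltW.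
pose u0 (x : 'rV[R]_n.+1) := profile f beta s1 (enorm x ^+ 2).
have u00 x : 0 <= u0 x by rewrite ltW// profile_gt0.
have mu0 : measurable_fun setT u0.
  apply: (@measurableT_comp _ _ _ _ _ _ (profile f beta s1)).
    exact: measurable_profile.
  apply: measurable_funX; exact: measurable_enorm.
exists u0; split => //.
  apply: bigF_negpow_profile_L1ul => //.
  rewrite mulrA ltr_pdivrMr// [ltRHS]mulrC -ltr_pdivrMr// -/q /beta; lra.
move=> T T0 [u usol].
pose b : R := gauss_spread R n.+1 + 4 * n.+1%:R.
have b_gt0 : 0 < b by rewrite addr_gt0 ?gauss_spread_gt0// mulr_gt0.
(* [z] is the blow-up time from the level [m], and [p] the squared radius on
   which that level is exceeded: the bound [u >= m] on the cylinder of half-width [L],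
   of order [sqrt p], is needed from [t0] to [t0 + 2 z], and is available until
   [p / (2 b)]. This, and the strict inequality [4 N z < L^2], follow from
   [M z <= p]. *)
pose M := 8 * b + 16 * n.+1%:R ^+ 2 + 1.
have N2 : 0 <= n.+1%:R ^+ 2 :> R by exact: sqr_ge0.
have M0 : 0 < M by rewrite /M; lra.
have bT : 0 < 2 * b * T by rewrite !mulr_gt0.
have [e e0 He] := small_exponents beta01 M0 bT.
have [m s1m Fme] := tailF_small hf hfpos hF s10 e0.
have m0 := lt_le_trans s10 s1m.
have z0 := tailF_gt0 hf hfpos hF m0; set z := tailF f m in Fme z0.
have [Mz zT] := He z z0 Fme.
pose p := z `^ beta; have p0 : 0 < p by rewrite powR_gt0.
pose sigma := tail_weight f beta m / beta.
have sigma0 : 0 < sigma by rewrite divr_gt0// (tail_weight_gt0 hf hfpos hF).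
have A0 : 0 <= m + sigma * p.
  by rewrite addr_ge0 ?(ltW m0)// mulr_ge0// ltW.
have f0 s : 0 <= s -> 0 <= f s by exact: C1_nonneg_ge0.
have u0A y : y != 0 -> m + sigma * p - sigma * enorm y ^+ 2 <= u0 y.
  move=> y0; have yp : 0 < enorm y ^+ 2 by rewrite exprn_gt0// enorm_gt0.
  have := profile_quadratic_ge hf hfpos hF beta01 s10 f'F s1m yp.
  by rewrite -/sigma -/z -/p -/(u0 y); lra.
have uge x t tT := solution_ge_quadratic usol f0 A0 sigma0 mu0 u00 u0A x (t := t) tT.
pose L := Num.sqrt (p / (4 * n.+1%:R)).
have N4 : 0 < 4 * n.+1%:R :> R by rewrite mulr_gt0.
have L0 : 0 < L by rewrite sqrtr_gt0 divr_gt0.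
have L2 : L ^+ 2 = p / (4 * n.+1%:R) by rewrite sqr_sqrtr// divr_ge0// ltW.
pose t0 := p / (4 * b).
have b4 : 0 < 4 * b by rewrite mulr_gt0.
have t00 : 0 < t0 by rewrite divr_gt0.
have bt0 : b * t0 = p / 4 by rewrite /t0; field; rewrite gt_eqF.
have zb : 8 * b * z <= p.
  apply: le_trans Mz; rewrite ler_pM2r// /M; lra.
have zN : 16 * n.+1%:R ^+ 2 * z < p.
  apply: lt_le_trans Mz; rewrite ltr_pM2r// /M; lra.
have endT : t0 + 2 * z < T.
  rewrite -(ltr_pM2l b_gt0) mulrDr bt0; move: zT; rewrite -/p; lra.
apply: (@no_large_cylinder _ _ f hf hfpos hf'pos hF u0 T u usol m L t0 m0 L0 t00 endT).
  rewrite L2 -/z ltr_pdivlMr//; lra.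
move=> y s yB /andP[t0s st].
have sT : 0 < s < T by rewrite (lt_le_trans t00)//= (le_lt_trans st).
apply: le_trans (uge y s sT).
have bs : b * s <= p / 4 + 2 * b * z.
  have := ler_wpM2l (ltW b_gt0) st; rewrite -/z mulrDr bt0; lra.
have yL : enorm y ^+ 2 <= p / 4.
  apply: le_trans (enorm_sqr_box yB) _; rewrite L2 le_eqVlt; apply/orP; left.
  by apply/eqP; field; rewrite gt_eqF.
suff : sigma * (2 * enorm y ^+ 2 + b * s) <= sigma * p by rewrite -/b; lra.
rewrite ler_pM2l//; lra.
Qed.
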